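(* Let $\Delta\in\mathbb C^{n\times n}$ be Hermitian and invertible, let $C,D\in\mathbb C^{n\times n}$ be $\Delta$-Hermitian, let $\alpha\in\mathbb R$, and suppose there is an invertible $U=[\,U_T\;\;U_C\,]$ with $$CU=U\,\mathrm{diag}(\alpha I_p+N,\ C_C),\qquad U^*\Delta U=\mathrm{diag}(\Delta_T,\Delta_C),\qquad \Delta_T=\mathrm{diag}(\Gamma_1,\dots,\Gamma_m),\qquad \alpha\notin\Lambda(C_C).$$ With the notation of the context, assume $W_1,\dots,W_m$ are all invertible, and fix $\rho\in\{1,\dots,m\}$. Suppose $F\in\mathbb C^{\rho s_\rho\times\ell}$ has full column rank and $$\Theta_\rho(S_\rho)F=F\Omega,\qquad F^*\Gamma_\rho F=\Delta_\Omega,\qquad F=[Q^T\ (Q\Omega)^T\ \dots\ (Q\Omega^{\rho-1})^T]^T,$$ where $\Omega\in\mathbb C^{\ell\times\ell}$, $Q\in\mathbb C^{s_\rho\times\ell}$ satisfies $S_\rho Q=Q\Omega^\rho$, and $\Delta_\Omega$ is a Hermitian block diagonal matrix of canonical form (see context). Suppose also $\Lambda(\Omega)\subseteq\Lambda(\Theta_\rho(S_\rho))$, the eigenvalues in $\Lambda(\Omega)$ are either real or in complex conjugate pairs, and $\Lambda(\Omega)\cap(\Lambda(\Theta_\rho(S_\rho))\setminus\Lambda(\Omega))=\emptyset$. Then for $t>0$ sufficiently small there is a perturbed structured basis $(\widetilde U_\rho(t),\widetilde\Theta_\rho(t))$ (defined in the context), and there exist matrices $\widetilde F(t)=F+O(t^{1/\rho})$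 and $\widetilde\Omega(t)=\Omega+O(t^{1/\rho})$ with $$\widetilde\Theta_\rho(t)\widetilde F(t)=\widetilde F(t)\widetilde\Omega(t),\qquad \widetilde F^*(t)\Gamma_\rho\widetilde F(t)=\Delta_\Omega,$$ such that the matrix $$\widetilde U_\Omega(t)=\widetilde U_\rho(t)\widetilde F(t)=E_\rho\begin{bmatrix}I_{s_\rho} \\ G_\rho\end{bmatrix}Q+\sum_{k=1}^mU_kL_{k\rho}(t)+O(t),$$ with $L_{k\rho}(t)=O(\delta_k(t))$ for $k\ne\rho$ and $$L_{\rho\rho}(t)=\big[\,0\ \ (Q(t^{1/\rho}\Omega))^T\ \dots\ (Q(t^{1/\rho}\Omega)^{\rho-1})^T\big]^T+O(\delta_\rho(t)),$$ satisfies $$(C+tD)\widetilde U_\Omega(t)=\widetilde U_\Omega(t)(\alpha I_\ell+t^{1/\rho}\widetilde\Omega(t)),\qquad \widetilde U_\Omega^*(t)\Delta\widetilde U_\Omega(t)=t^{1-1/\rho}\Delta_\Omega.$$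
   Context: A matrix $C$ is $\Delta$-Hermitian (for Hermitian invertible $\Delta$) if $\Delta C=(\Delta C)^*$. $\Lambda(\cdot)$ is the spectrum; in the conditions relating $\Lambda(\Omega)$ and $\Lambda(\Theta_\rho(S_\rho))$ spectra are multisets (eigenvalues counted with algebraic multiplicity), so the condition says that no eigenvalue of $\Omega$ is among the remaining eigenvalues of $\Theta_\rho(S_\rho)$. $^*$ is conjugate transpose. Jordan structure: integers $m\ge1$, $s_1,\dots,s_{m-1}\ge0$, $s_m>0$, $p=\sum_{j=1}^m js_j$, $N=\mathrm{diag}(N_1,\dots,N_m)$, where $N_j$ is the $j\times j$ block matrix with blocks of size $s_j\times s_j$, having $I_{s_j}$ on the first block superdiagonal and zeros elsewhere ($N_1=0_{s_1}$). For each $k$, $\Sigma_k=\mathrm{diag}(I_{t_k},-I_{s_k-t_k})$ with an integer $0\le t_k\le s_k$, and $\Gamma_k$ is the $k\times k$ block matrix with $s_k\times s_k$ blocks having $\Sigma_k$ in every block position on the block antidiagonal and zeros elsewhere. Canonical form of $\Delta_\Omega$: $\Delta_\Omega$ is block diagonal, each diagonal block being either $\begin{bmatrix}0 & I_r \\ I_r & 0\end{bmatrix}$ for some $r$, or a block antidiagonal matrix (a $k\times k$ block matrix for some $k\ge1$) with the same signature matrix $\mathrm{diag}(I_a,-I_b)$ in each antidiagonal block; in particular $\Delta_\Omega=\Delta_\Omega^*=\Delta_\Omega^{-1}$. Partitions: $U_T=[U_1\ \dots\ U_m]$ with $U_j$ having $js_j$ columns, $U_j=[U_{j1}\ \dots\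 U_{jj}]$ with each block having $s_j$ columns; $E_k=[U_{k1}\ U_{k+1,1}\ \dots\ U_{m1}]$, $\widehat W_k=E_k^*\Delta DE_k$, $W_k=\mathrm{diag}(\Sigma_k,\dots,\Sigma_m)\widehat W_k$, $k=1,\dots,m$. For $\rho<m$: $G_\rho=-\widehat W_{\rho+1}^{-1}E_{\rho+1}^*\Delta DU_{\rho1}$ and $S_\rho=\Sigma_\rho U_{\rho1}^*\Delta D(U_{\rho1}+E_{\rho+1}G_\rho)$. For $\rho=m$: $G_\rho$ is absent (empty) and $S_m=\Sigma_mU_{m1}^*\Delta DU_{m1}$. $\Theta_\rho(S)$ is the $\rho\times\rho$ block matrix with $s_\rho\times s_\rho$ blocks, with $I_{s_\rho}$ on the first block superdiagonal, $S$ in the bottom-left block, zeros elsewhere ($\Theta_1(S)=S$). Order notation: $t>0$ is real and sufficiently small; $O(t^d)$ is a matrix with norm at most a constant (independent of $t$) times $t^d$ for all sufficiently small $t>0$. For a matrix with $k$ block rows, $O([t^{d_1}\ \dots\ t^{d_k}]^T)$ means the $i$th block row is $O(t^{d_i})$. For fixed $\rho$, $\delta_k(t)$ is the following vector of length $k$ (applied to matrices with $k$ block rows of height $s_k$): for $k<\rho$, $[t^{1-k/\rho}\ t^{1-(k-1)/\rho}\ \dots\ t^{1-1/\rho}]^T$; for $k=\rho$, $[t^{1/\rho}\ t^{2/\rho}\ \dots\ t]^T$; for $k>\rho$, $[t^{1/\rho}\ t^{1/\rho}\ t^{2/\rho}\ \dots\ t\ \dots\ t]^T$, i.e. first entry $t^{1/\rho}$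 and $i$th entry $t^{\min(i-1,\rho)/\rho}$ for $i\ge2$. Perturbed structured basis: a family (for all sufficiently small $t>0$) of matrices $\widetilde U_\rho(t)\in\mathbb C^{n\times\rho s_\rho}$, $\widetilde\Theta_\rho(t)=\Theta_\rho(S_\rho)+O(t^{1/\rho})$ with $$\widetilde U_\rho(t)=E_\rho\begin{bmatrix}I_{s_\rho} & 0 \\ G_\rho & 0\end{bmatrix}+\sum_{k=1}^mU_k\widetilde X_{k\rho}(t)+O(t),$$ $\widetilde X_{k\rho}=O(\delta_k)$ for $k\ne\rho$, $\widetilde X_{\rho\rho}=\mathrm{diag}(0_{s_\rho},t^{1/\rho}I_{s_\rho},\dots,t^{1-1/\rho}I_{s_\rho})+O(\delta_\rho)$, such that $(C+tD)\widetilde U_\rho(t)=\widetilde U_\rho(t)(\alpha I_{\rho s_\rho}+t^{1/\rho}\widetilde\Theta_\rho(t))$ and $\widetilde U_\rho^*(t)\Delta\widetilde U_\rho(t)=t^{1-1/\rho}\Gamma_\rho$. *)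

(* Defs.v *)
From mathcomp Require Import all_boot all_order all_algebra.
From mathcomp Require Export complex finmap multiset.
From mathcomp Require Import all_classical all_reals all_analysis.

Set Implicit Arguments.
Unset Strict Implicit.
Unset Printing Implicit Defensive.

Import Order.TTheory GRing.Theory Num.Theory.
Import numFieldNormedType.Exports.

Local Open Scope classical_set_scope.
Local Open Scope ring_scope.
Local Open Scope complex_scope.
Local Open Scope sesquilinear_scope.

(* The block sizes s k, the block indices U k i and rho are 1-based natural
   numbers; positions inside the library's block matrices are ordinals, hence
   0-based.  The signature parameters t_k are called tau k, since t is the
   perturbation parameter. *)

Section Blocks.
Variable K : numClosedFieldType.

(* diag(I_a, -I_(r-a)) for a <= r *)
Definition signature (r a : nat) : 'M[K]_r :=
  diag_mx (\row_(i < r) (if (i < a)%N then 1 else -1)).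

Definition antidiag_block (k r : nat) (A : 'M[K]_r) : 'M[K]_(\sum_(i < k) r) :=
  \mxblock_(i < k, j < k) (if ((i + j).+1 == k)%N then A else 0 : 'M[K]_r).

Definition shift_block (k r : nat) : 'M[K]_(\sum_(i < k) r) :=
  \mxblock_(i < k, j < k) (if j == i.+1 :> nat then 1%:M else 0 : 'M[K]_r).

(* For k = 1 the only block is the bottom-left one, so Theta 1 S is S. *)
Definition Theta (k r : nat) (S : 'M[K]_r) : 'M[K]_(\sum_(i < k) r) :=
  \mxblock_(i < k, j < k)
    (if j == i.+1 :> nat then 1%:M
     else if (i.+1 == k) && (j == 0%N :> nat) then S else 0 : 'M[K]_r).

Inductive canonical_block : forall l : nat, 'M[K]_l -> Prop :=
| CanonicalSwap (r : nat) :
    canonical_block (block_mx 0 1%:M 1%:M 0 : 'M[K]_(r + r))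
| CanonicalAnti (k a b : nat) : (0 < k)%N ->
    canonical_block (antidiag_block k (signature (a + b) a)).

Inductive canonical_form : forall l : nat, 'M[K]_l -> Prop :=
| CanonicalForm (q : nat) (d : 'I_q -> nat) (B : forall i, 'M[K]_(d i)) :
    (forall i, canonical_block (B i)) -> canonical_form (\mxdiag_i B i).

(* eigenvalues, counted with algebraic multiplicity *)
Definition spectrum (l : nat) (A : 'M[K]_l) : {mset K}%mset :=
  seq_mset (sval (closed_field_poly_normal (char_poly A))).

Definition total_size (m : nat) (s : nat -> nat) : nat :=
  (\sum_(j < m) \sum_(i < j.+1) s j.+1)%N.

Definition Nmx (m : nat) (s : nat -> nat) : 'M[K]_(total_size m s) :=
  \mxdiag_(j < m) shift_block j.+1 (s j.+1).

Definition Gammamx (s tau : nat -> nat) (k : nat) :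
    'M[K]_(\sum_(i < k) s k) :=
  antidiag_block k (signature (s k) (tau k)).

Definition DeltaT (m : nat) (s tau : nat -> nat) : 'M[K]_(total_size m s) :=
  \mxdiag_(j < m) Gammamx s tau j.+1.

End Blocks.

Section Structure.
Variables (K : numClosedFieldType) (n m : nat) (s tau : nat -> nat).
(* U k i is the block U_{ki} (1 <= i <= k <= m); other values are not used. *)
Variable U : forall k i : nat, 'M[K]_(n, s k).
Variables Delta D : 'M[K]_n.

Definition Ublock (k : nat) : 'M[K]_(n, \sum_(i < k) s k) :=
  \mxrow_(i < k) U k i.+1.

Definition UT : 'M[K]_(n, total_size m s) := \mxrow_(j < m) Ublock j.+1.

(* Matrices indexed by a list of block indices, so that the lists [k; ...; m]
   and rho :: [rho+1; ...; m] can both be used. *)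
Fixpoint width (js : seq nat) : nat :=
  if js is j :: js' then (s j + width js')%N else 0%N.

Fixpoint Emx (js : seq nat) : 'M[K]_(n, width js) :=
  if js is j :: js' return 'M[K]_(n, width js)
  then row_mx (U j 1) (Emx js') else 0.

Fixpoint diag_signature (js : seq nat) : 'M[K]_(width js) :=
  if js is j :: js' return 'M[K]_(width js)
  then block_mx (signature K (s j) (tau j)) 0 0 (diag_signature js') else 0.

Definition What (js : seq nat) : 'M[K]_(width js) :=
  (Emx js)^t* *m Delta *m D *m Emx js.

Definition Wmx (js : seq nat) : 'M[K]_(width js) :=
  diag_signature js *m What js.

(* [k; ...; m], empty for k = m + 1; E_k is Emx (from k) *)
Definition from (k : nat) : seq nat := index_iota k m.+1.

(* For rho = m this matrix has no rows, which encodes its absence. *)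
Definition Gmx (rho : nat) : 'M[K]_(width (from rho.+1), s rho) :=
  - (invmx (What (from rho.+1)) *m
       ((Emx (from rho.+1))^t* *m Delta *m D *m U rho 1)).

(* For rho = m the second summand is a product through dimension 0. *)
Definition Smx (rho : nat) : 'M[K]_(s rho) :=
  signature K (s rho) (tau rho) *m (U rho 1)^t* *m Delta *m D *m
    (U rho 1 + Emx (from rho.+1) *m Gmx rho).

(* E_rho, with its first block U_{rho 1} split off *)
Definition Erho (rho : nat) : 'M[K]_(n, s rho + width (from rho.+1)) :=
  Emx (rho :: from rho.+1).

Definition IG (rho : nat) : 'M[K]_(s rho + width (from rho.+1), s rho) :=
  col_mx 1%:M (Gmx rho).

(* [I 0; G 0] with rho block columns *)
Definition IG0 (rho : nat) :
    'M[K]_(s rho + width (from rho.+1), \sum_(i < rho) s rho) :=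
  \mxrow_(i < rho) (if i == 0%N :> nat then IG rho else 0 : 'M[K]_(_, s rho)).

End Structure.

Section Asymptotics.
Variable R : realType.

Definition tpow (t d : R) : R[i] := (t `^ d)%:C.

(* A t = O(t^d) for small t > 0.  mx_norm is the largest modulus of an entry;
   the order of R[i] compares real parts of numbers with equal imaginary
   parts. *)
Definition bigO_t (a b : nat) (d : R) (A : R -> 'M[R[i]]_(a, b)) : Prop :=
  exists c : R, \forall t \near 0^'+, mx_norm (A t) <= c%:C * tpow t d.

Definition bigO_rows (k r b : nat) (d : 'I_k -> R)
    (A : R -> 'M[R[i]]_(\sum_(i < k) r, b)) : Prop :=
  forall i : 'I_k, bigO_t (d i) (fun t => submxcol (A t) i).

(* exponents of delta_k; the 0-based i is the (i+1)st entry *)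
Definition delta_exp (rho k : nat) (i : 'I_k) : R :=
  if (k < rho)%N then 1 - (k - i)%N%:R / rho%:R
  else if k == rho then i.+1%:R / rho%:R
  else if i == 0%N :> nat then 1 / rho%:R
  else (minn i rho)%:R / rho%:R.

(* diag(0, t^(1/rho) I, ..., t^(1-1/rho) I) *)
Definition Xlead (rho r : nat) (t : R) : 'M[R[i]]_(\sum_(i < rho) r) :=
  \mxdiag_(i < rho)
    (if i == 0%N :> nat then 0
     else (tpow t (i%:R / rho%:R))%:M : 'M[R[i]]_r).

Section Basis.
Variables (n m : nat) (s tau : nat -> nat).
Variables (U : forall k i : nat, 'M[R[i]]_(n, s k)) (Delta C D : 'M[R[i]]_n).
Variables (alpha : R) (rho : nat).

Definition perturbed_structured_basis
    (Ut : R -> 'M[R[i]]_(n, \sum_(i < rho) s rho))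
    (Tt : R -> 'M[R[i]]_(\sum_(i < rho) s rho)) : Prop :=
  [/\ bigO_t (1 / rho%:R)
        (fun t => Tt t - Theta rho (Smx m tau U Delta D rho)),
      exists X : forall k : nat,
          R -> 'M[R[i]]_(\sum_(i < k) s k, \sum_(i < rho) s rho),
        [/\ bigO_t 1 (fun t => Ut t -
              (Erho m U rho *m IG0 m U Delta D rho +
               \sum_(1 <= k < m.+1) Ublock U k *m X k t)),
            forall k : nat, (1 <= k <= m)%N -> k != rho ->
              bigO_rows (@delta_exp rho k) (X k)
          & bigO_rows (@delta_exp rho rho)
              (fun t => X rho t - Xlead rho (s rho) t)]
    & \forall t \near 0^'+,
        (C + t%:C *: D) *m Ut t =
          Ut t *m ((alpha%:C)%:M + tpow t (1 / rho%:R) *: Tt t)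
        /\ (Ut t)^t* *m Delta *m Ut t =
          tpow t (1 - 1 / rho%:R) *: Gammamx _ s tau rho].

End Basis.
End Asymptotics.

(* Main.v *)
(* Put eps = t^(1/rho) and work in coordinates with respect to U.  Scaling block
   row (k, i) by the power of eps predicted by delta_k turns the equation
   (C + tD) Y = Y (alpha + eps Theta) into calA(eps) Z = calM(eps) Z Theta with
   matrices that are polynomial in eps, and at eps = 0 it has a unique solution
   with the prescribed rho-th block: the conditions with k > rho give G_rho and
   the rho-th block then gives Theta_rho(S_rho).  Taking Theta = P calA(eps) Z,
   where P selects the rho-th block, makes this a quadratic equation in Z with
   invertible linearization, so a contraction argument yields a solution that is
   O(eps)-close to the limit.  Right multiplication by a matrix T = 1 + O(eps)
   with T^* (Z^* Delta Z) T = Gamma_rho makes the Gram matrix exact.  The spectral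
   gap of Omega gives, by the same contraction argument for a Riccati equation, an
   invariant subspace of Theta(t) near the range of F, which is normalized in the
   same way. *)

(* The pair (Z, Theta) is determined only up to (Z T, T^-1 Theta T). The choice Theta = P calA(eps)
   Z removes this freedom, because calM leaves the rho-th block rows unchanged and P Z = 1 in the
   limit; the freedom is spent afterwards on the Gram matrix. The weights are such that eps^(rho-1)
   divides the scaled Gram matrix and the quotient at eps = 0 lives in the rho-th group, where it is
   Gamma_rho: this is the origin of the factor t^(1-1/rho). Since calM(0) is in general singular,
   the limit equation is a generalized Sylvester equation A H = M H T. Its injectivity is checked
   row by row and rests on the invertibility of Theta_rho(S_rho), of C_C - alpha and of the matrices
   W_k. The basis, the normalization and the invariant subspace all lead to A H + c = M H (T + Q H)
   with small H. Uniqueness of the small solution matters as much as existence: it makes the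
   normalizing factor self-adjoint for the limit form, which turns a quadratic equation into a
   congruence. *)
Require Import Defs.
From mathcomp Require Import all_boot all_order all_algebra.
From mathcomp Require Import all_classical all_reals all_analysis.
From mathcomp Require Import ring lra zify.

Set Implicit Arguments.
Unset Strict Implicit.
Unset Printing Implicit Defensive.

Import Order.TTheory GRing.Theory Num.Theory.
Import numFieldNormedType.Exports.

Local Open Scope classical_set_scope.
Local Open Scope ring_scope.
Local Open Scope complex_scope.
Local Open Scope sesquilinear_scope.

(** * Absolute values and contractions *)

(* [of_real] plays the role of the embedding x |-> x%:C. *)
Record modulus (R : realType) (K : numClosedFieldType) := Modulus {
  md :> K -> R;
  of_real : {rmorphism R -> K};
  md_ge0 : forall z, 0 <= md z;
  md_eq0 : forall z, md z = 0 -> z = 0;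
  mdM : forall z z', md (z * z') = md z * md z';
  md_leD : forall z z', md (z + z') <= md z + md z';
  md_conj : forall z, md (Num.conj z) = md z;
  md_real : forall x, 0 <= x -> md (of_real x) = x;
  conj_of_real : forall x, Num.conj (of_real x) = of_real x;
  md_complete : forall (u : nat -> K) (L : R),
    (forall n, md (u n.+1 - u n) <= L / 2 ^+ n.+1) ->
    exists l, forall n, md (u n - l) <= L *+ 2 / 2 ^+ n }.

Section EntrywiseNorm.
Variables (R : realType) (K : numClosedFieldType) (M : modulus R K).

(* The sum of the moduli of the entries; unlike [mx_norm] it is
   submultiplicative. *)
Definition nrm a b (A : 'M[K]_(a, b)) : R := \sum_i \sum_j md M (A i j).

Lemma md0 : md M 0 = 0.
Proof. by rewrite -(rmorph0 (of_real M)) md_real. Qed.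

Lemma mdN z : md M (- z) = md M z.
Proof.
have N1 : md M (-1) = 1.
  apply/eqP; rewrite -(@pexpr_eq1 _ _ 2) ?md_ge0 // expr2 -mdM mulrNN mulr1.
  by rewrite -(rmorph1 (of_real M)) md_real.
by rewrite -mulN1r mdM N1 mul1r.
Qed.

Lemma nrm_ge0 a b (A : 'M[K]_(a, b)) : 0 <= nrm A.
Proof. by do 2!apply: sumr_ge0 => ? _; apply: md_ge0. Qed.

Lemma nrm_entry a b (A : 'M[K]_(a, b)) i j : md M (A i j) <= nrm A.
Proof.
rewrite /nrm (bigD1 i) //= (bigD1 j) //= -addrA lerDl addr_ge0 //.
  by apply: sumr_ge0 => ? _; apply: md_ge0.
by do 2!apply: sumr_ge0 => ? _; apply: md_ge0.
Qed.

Lemma nrm0 a b : nrm (0 : 'M[K]_(a, b)) = 0.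
Proof.
by rewrite /nrm big1 // => i _; rewrite big1 // => j _; rewrite mxE md0.
Qed.

Lemma nrm_eq0 a b (A : 'M[K]_(a, b)) : nrm A <= 0 -> A = 0.
Proof.
move=> A0; apply/matrixP => i j; rewrite mxE; apply: (md_eq0 (m := M)).
by apply/eqP; rewrite eq_le md_ge0 (le_trans (nrm_entry _ _ _)).
Qed.

Lemma nrmN a b (A : 'M[K]_(a, b)) : nrm (- A) = nrm A.
Proof.
by do 2!apply: eq_bigr => ? _; rewrite mxE mdN.
Qed.

Lemma ler_nrmD a b (A B : 'M[K]_(a, b)) : nrm (A + B) <= nrm A + nrm B.
Proof.
rewrite /nrm -big_split; apply: ler_sum => i _ /=.
by rewrite -big_split; apply: ler_sum => j _ /=; rewrite mxE md_leD.
Qed.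

Lemma ler_nrmB a b (A B : 'M[K]_(a, b)) : nrm (A - B) <= nrm A + nrm B.
Proof. by rewrite -[nrm B]nrmN ler_nrmD. Qed.

Lemma md_sum (I : finType) (F : I -> K) :
  md M (\sum_i F i) <= \sum_i md M (F i).
Proof.
elim/big_rec2: _ => [|i y x _ le_xy]; first by rewrite md0.
by apply: le_trans (md_leD M _ _) _; rewrite lerD2l.
Qed.

Lemma ler_nrmM a b c (A : 'M[K]_(a, b)) (B : 'M[K]_(b, c)) :
  nrm (A *m B) <= nrm A * nrm B.
Proof.
rewrite /nrm mulr_suml; apply: ler_sum => i _.
apply: (@le_trans _ _ (\sum_k \sum_j md M (A i j) * md M (B j k))).
  apply: ler_sum => k _; rewrite mxE; apply: le_trans (md_sum _) _.
  by apply: ler_sum => j _; rewrite mdM.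
rewrite exchange_big mulr_suml; apply: ler_sum => j _ /=.
rewrite -mulr_sumr ler_wpM2l ?md_ge0 // (bigD1 j) //= lerDl.
by do 2!apply: sumr_ge0 => ? _; apply: md_ge0.
Qed.

Lemma nrmZ a b (z : K) (A : 'M[K]_(a, b)) :
  nrm (z *: A) = md M z * nrm A.
Proof.
rewrite /nrm mulr_sumr; apply: eq_bigr => i _; rewrite mulr_sumr.
by apply: eq_bigr => j _; rewrite mxE mdM.
Qed.

Lemma nrm_adj a b (A : 'M[K]_(a, b)) : nrm (A^t*) = nrm A.
Proof.
rewrite /nrm exchange_big; apply: eq_bigr => i _; apply: eq_bigr => j _.
by rewrite !mxE md_conj.
Qed.

End EntrywiseNorm.

Section Contraction.
Variable R : realType.

(** Used to pass to the limit in inequalities: if y < x, some power of 2 exceeds K / (x - y), which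
    contradicts the assumption for that [n]. *)
Lemma le_add_halves (x y K : R) : 0 <= K ->
  (forall n : nat, x <= y + K / 2 ^+ n) -> x <= y.
Proof.
move=> K0 le_xy; rewrite leNgt; apply/negP => lt_yx.
have d0 : 0 < x - y by rewrite subr_gt0.
pose n := (Num.truncn (K / (x - y))).+1.
have := le_xy n; apply/negP; rewrite -ltNge -ltrBrDl.
have n0 : (0 : R) < 2 ^+ n by rewrite exprn_gt0.
rewrite ltr_pdivrMr // -ltr_pdivrMl // mulrC.
apply: lt_le_trans (_ : n%:R <= _); first by rewrite truncnS_gt.
by rewrite -natrX ler_nat ltnW // ltn_expl.
Qed.

(** The intervals of radius K / 2^n around [u n] are nested, since a step and the next radius add up
    to the current radius. The limit is the supremum of their left ends. *)
Lemma halving_seq_lim (u : nat -> R) (K : R) :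
  (forall n, `|u n.+1 - u n| <= K / 2 ^+ n.+1) ->
  exists l, forall n, `|u n - l| <= K / 2 ^+ n.
Proof.
move=> uK; have half n : K / 2 ^+ n = K / 2 ^+ n.+1 + K / 2 ^+ n.+1.
  by rewrite exprSr invfM mulrA [RHS]addrC -splitr.
have incr n k : u n - K / 2 ^+ n <= u (n + k)%N - K / 2 ^+ (n + k).
  elim: k => [|k /le_trans->//]; first by rewrite addn0.
  rewrite addnS; have := uK (n + k)%N; rewrite ler_norml => /andP[+ _].
  have := half (n + k)%N; lra.
have decr n k : u (n + k)%N + K / 2 ^+ (n + k) <= u n + K / 2 ^+ n.
  elim: k => [|k IHk]; first by rewrite addn0.
  apply: le_trans IHk; rewrite addnS.
  have := uK (n + k)%N; rewrite ler_norml => /andP[_].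
  have := half (n + k)%N; lra.
have K0 n : 0 <= K / 2 ^+ n.
  by rewrite half addr_ge0 // (le_trans _ (uK n)).
have cross n k : u n - K / 2 ^+ n <= u k + K / 2 ^+ k.
  apply: le_trans (incr n k) _; rewrite [in leRHS]addrC.
  apply: le_trans (_ : u (n + k)%N + K / 2 ^+ (n + k) <= _); last first.
    by rewrite addnC [K / _ + u k]addrC decr.
  by rewrite lerD2l ge0_cp.
pose E := range (fun n => u n - K / 2 ^+ n).
have E0 : E !=set0 by exists (u 0%N - K / 2 ^+ 0); exists 0%N.
have ubE n : ubound E (u n + K / 2 ^+ n) by move=> _ [k _ <-].
exists (sup E) => n; rewrite ler_norml; apply/andP; split.
  have := @ge_sup _ _ _ E0 (ubE n); lra.
have : u n - K / 2 ^+ n <= sup E.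
  apply: ub_le_sup; first by exists (u n + K / 2 ^+ n).
  by exists n.
lra.
Qed.

Section FixedPoint.
Variables (K : numClosedFieldType) (M : modulus R K).

(** Iteration from 0: a first step of at most r / 2 and the Lipschitz constant 1/2 keep all iterates
    in the ball of radius r and halve the steps. *)
Lemma contraction_fixpoint a b (Phi : 'M[K]_(a, b) -> 'M[K]_(a, b)) (r : R) :
  nrm M (Phi 0) <= r / 2 ->
  (forall X Y, nrm M X <= r -> nrm M Y <= r ->
     nrm M (Phi X - Phi Y) <= nrm M (X - Y) / 2) ->
  exists2 H, nrm M H <= r & Phi H = H.
Proof.
move=> Phi0 Phi_lip.
have r0 : 0 <= r by have := le_trans (nrm_ge0 M _) Phi0; lra.
pose u n := iter n Phi 0.
have u_in n : nrm M (u n) <= r.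
  elim: n => [|n IHn]; first by rewrite nrm0.
  rewrite /= -[Phi _](subrK (Phi 0)); apply: le_trans (ler_nrmD M _ _) _.
  have := Phi_lip (u n) 0 IHn; rewrite nrm0 subr0 => /(_ r0); lra.
have u_step n : nrm M (u n.+1 - u n) <= r / 2 ^+ n.+1.
  elim: n => [|n IHn]; first by rewrite /= subr0 expr1.
  apply: (le_trans (Phi_lip _ _ (u_in n.+1) (u_in n))).
  by rewrite [2 ^+ n.+2]exprSr invfM mulrA ler_wpM2r // invr_ge0.
have /choice[l lP] (ij : 'I_a * 'I_b) : exists l, forall n,
    md M (u n ij.1 ij.2 - l) <= r *+ 2 / 2 ^+ n.
  apply: md_complete => n; apply: le_trans (u_step n).
  by apply: le_trans (nrm_entry M _ ij.1 ij.2); rewrite !mxE.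
pose H : 'M[K]_(a, b) := \matrix_(i, j) l (i, j).
(* The entrywise bound [r *+ 2] summed over the a * b entries. *)
pose L := r *+ 2 *+ b *+ a.
have L0 : 0 <= L by rewrite !mulrn_wge0.
have uH n : nrm M (u n - H) <= L / 2 ^+ n.
  rewrite /L 2!mulrnAl -[X in _ *+ _ *+ X]card_ord -sumr_const.
  apply: ler_sum => i _; rewrite -[X in _ *+ X]card_ord -sumr_const.
  by apply: ler_sum => j _; rewrite !mxE; apply: (lP (i, j)).
have H_in : nrm M H <= r.
  apply: (le_add_halves L0) => n; rewrite -[H](subrK (u n)) addrC.
  apply: le_trans (ler_nrmD M _ _) _; rewrite lerD ?u_in //.
  by rewrite -nrmN opprB uH.
exists H => //; apply/eqP; rewrite -subr_eq0; apply/eqP/nrm_eq0.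
have L20 : 0 <= L + L by rewrite addr_ge0.
apply: (le_add_halves L20) => n; rewrite add0r.
rewrite (_ : Phi H - H = (Phi H - Phi (u n)) + (u n.+1 - H)); last first.
  by rewrite /= addrA subrK.
apply: le_trans (ler_nrmD M _ _) _; rewrite mulrDl lerD //.
  apply: le_trans (Phi_lip _ _ H_in (u_in _)) _.
  rewrite -nrmN opprB ler_pdivrMr //; apply: le_trans (uH n) _.
  by rewrite ler_peMr // ?mulr_ge0 ?invr_ge0 ?exprn_ge0 //; lra.
apply: le_trans (uH _) _; rewrite ler_wpM2l //.
by rewrite lef_pV2 ?posrE ?exprn_gt0 // ler_weXn2l // ler1n.
Qed.

End FixedPoint.
End Contraction.

(** * The modulus of complex numbers over a real field *)

Section ComplexModulus.
Variable R : realType.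
Local Notation C := R[i].
Local Notation Re := complex.Re.
Local Notation Im := complex.Im.

Lemma normc_normE (z : C) : `|z| = (Normc.normc z)%:C.
Proof. by case: z. Qed.

Lemma normc_ge0 (z : C) : 0 <= Normc.normc z.
Proof. by case: z => x y; apply: sqrtr_ge0. Qed.

Lemma normc_conj (z : C) : Normc.normc (Num.conj z) = Normc.normc z.
Proof. by apply: complexI; rewrite -!normc_normE norm_conjC. Qed.

Lemma normc_real (x : R) : 0 <= x -> Normc.normc x%:C = x.
Proof. by move=> x0 /=; rewrite expr0n addr0 sqrtr_sqr ger0_norm. Qed.

Lemma normc_Re (z : C) : `|Re z| <= Normc.normc z.
Proof.
case: z => x y /=; rewrite -sqrtr_sqr; apply: ler_wsqrtr.
by rewrite lerDl sqr_ge0.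
Qed.

Lemma normc_Im (z : C) : `|Im z| <= Normc.normc z.
Proof.
case: z => x y /=; rewrite -sqrtr_sqr; apply: ler_wsqrtr.
by rewrite lerDr sqr_ge0.
Qed.

Lemma normc_le (z : C) : Normc.normc z <= `|Re z| + `|Im z|.
Proof.
case: z => x y /=.
rewrite -(ger0_norm (addr_ge0 (normr_ge0 x) (normr_ge0 y))) -sqrtr_sqr.
apply: ler_wsqrtr.
by rewrite sqrrD !real_normK ?num_real // addrAC lerDl mulrn_wge0 // mulr_ge0.
Qed.

(** Real and imaginary parts converge separately, each within L / 2^n; adding the two errors gives
    the factor 2. *)
Lemma complex_complete (u : nat -> C) (L : R) :
  (forall n, Normc.normc (u n.+1 - u n) <= L / 2 ^+ n.+1) ->
  exists l, forall n, Normc.normc (u n - l) <= L *+ 2 / 2 ^+ n.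
Proof.
move=> uL.
have [x xP] : exists l, forall n, `|Re (u n) - l| <= L / 2 ^+ n.
  apply: halving_seq_lim => n; apply: le_trans (uL n).
  by apply: le_trans (normc_Re _); case: (u n.+1); case: (u n).
have [y yP] : exists l, forall n, `|Im (u n) - l| <= L / 2 ^+ n.
  apply: halving_seq_lim => n; apply: le_trans (uL n).
  by apply: le_trans (normc_Im _); case: (u n.+1); case: (u n).
exists (Complex x y) => n; apply: le_trans (normc_le _) _.
rewrite mulrnAl mulr2n; move: (xP n) (yP n).
by case: (u n) => ? ?; apply: lerD.
Qed.

Lemma conjc_of_real (x : R) : Num.conj (x%:C : C) = x%:C.
Proof. by apply: conj_Creal; rewrite complex_real. Qed.

Definition complex_modulus : modulus R C :=
  Modulus (of_real := real_complex R) normc_ge0 (@Normc.eq0_normc R)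
    (@Normc.normcM R) (@le_normcD R) normc_conj normc_real conjc_of_real
    complex_complete.

Lemma mx_norm_le_nrm a b (A : 'M[C]_(a, b)) :
  mx_norm A <= (nrm complex_modulus A)%:C.
Proof.
have [->|/mx_norm_neq0[i ->]] := eqVneq (mx_norm A) 0.
  by rewrite lecR nrm_ge0.
by rewrite normc_normE lecR (nrm_entry complex_modulus).
Qed.

End ComplexModulus.

Lemma mxDE (V : nmodType) a b (A B : 'M[V]_(a, b)) i j :
  (A + B) i j = A i j + B i j.
Proof. by rewrite mxE. Qed.

Lemma mxNE (V : zmodType) a b (A : 'M[V]_(a, b)) i j : (- A) i j = - A i j.
Proof. by rewrite mxE. Qed.

Lemma mx0E (V : nmodType) a b i j : (0 : 'M[V]_(a, b)) i j = 0.
Proof. by rewrite mxE. Qed.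

(** Rectangular matrices form no ring, so additive identities are checked entrywise, with matrix
    products as atoms; [mx_ring] first expands the products. *)
Ltac mx_abel :=
  let i := fresh in let j := fresh in
  apply/matrixP => i j; rewrite !(mxDE, mxNE, mx0E); ring.

Ltac mx_ring :=
  rewrite ?(mulmxDl, mulmxDr, mulmxN, mulNmx) ?mulmxA; mx_abel.

(** Vectorization represents H |-> A0 H - M0 H T0 by a square matrix, for which injectivity is
    invertibility. This allows a singular M0. *)
Lemma sylvester_matrix (F : fieldType) a b (A0 M0 : 'M[F]_a) (T0 : 'M[F]_b) :
  (forall H, A0 *m H = M0 *m H *m T0 -> H = 0) ->
  exists2 L : 'M[F]_(a * b), L \in unitmx &
    forall H, mxvec H *m L = mxvec (A0 *m H - M0 *m H *m T0).
Proof.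
move=> inj0.
pose L := lin_mulmx A0 - lin_mulmx M0 *m lin_mulmxr T0 : 'M[F]_(a * b).
have LE H : mxvec H *m L = mxvec (A0 *m H - M0 *m H *m T0).
  by rewrite mulmxBr mulmxA !mul_vec_lin /= linearB.
exists L => //; rewrite -row_free_unit; apply: inj_row_free => v.
rewrite -[v]vec_mxK LE => /(congr1 vec_mx); rewrite mxvecK linear0.
by move/eqP; rewrite subr_eq0 => /eqP/inj0 ->; rewrite linear0.
Qed.

(** * Order estimates and quadratic matrix equations *)

Section Asymptotic.
Variables (R : realType) (K : numClosedFieldType) (mod : modulus R K).
Local Notation nrm := (nrm mod).
Implicit Types (d : R) (t : R).

(** The estimate [bigO_t] for the submultiplicative [nrm], so that orders add under products without
    constants depending on the dimensions. *)
Definition bO a b d (A : R -> 'M[K]_(a, b)) : Prop :=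
  exists c : R, \forall t \near 0^'+, nrm (A t) <= c * t `^ d.

Lemma near_pos : \forall t \near (0 : R)^'+, 0 < t.
Proof. exact: nbhs_right_gt. Qed.

Lemma near_powR_le d e : 0 < d -> 0 < e -> \forall t \near 0^'+, t `^ d <= e.
Proof.
move=> d0 e0; near=> t.
have t0 : 0 < t by near: t; apply: near_pos.
have te : t < e `^ d^-1 by near: t; apply: nbhs_right_lt; rewrite powR_gt0.
have -> : e = (e `^ d^-1) `^ d by rewrite -powRrM mulVf ?gt_eqF // powRr1 // ltW.
by apply: ge0_ler_powR; rewrite ?nnegrE ?powR_ge0 ?ltW.
Unshelve. all: by end_near. Qed.

Lemma bO_near a b d (A B : R -> 'M[K]_(a, b)) :
  (\forall t \near 0^'+, A t = B t) -> bO d B -> bO d A.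
Proof.
move=> AB [c Bc]; exists c; near=> t.
have -> : A t = B t by near: t.
by near: t.
Unshelve. all: by end_near. Qed.

Lemma bO_ext a b d (A B : R -> 'M[K]_(a, b)) : A =1 B -> bO d B -> bO d A.
Proof. by move=> AB; apply: bO_near; near=> t. Unshelve. all: by end_near. Qed.

Lemma bO_pos a b d (A : R -> 'M[K]_(a, b)) : bO d A ->
  exists2 c, 0 < c & \forall t \near 0^'+, nrm (A t) <= c * t `^ d.
Proof.
case=> c Ac; exists (Num.max c 1); first by rewrite lt_max ltr01 orbT.
near=> t; apply: (@le_trans _ _ (c * t `^ d)); first by near: t.
by rewrite ler_wpM2r ?powR_ge0 // le_max lexx.
Unshelve. all: by end_near. Qed.

Lemma bO_le a b d d' (A : R -> 'M[K]_(a, b)) : d' <= d -> bO d A -> bO d' A.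
Proof.
move=> dd' /bO_pos[c c0 Ac]; exists c; near=> t.
have t0 : 0 < t by near: t; apply: near_pos.
have t1 : t < 1 by near: t; apply: nbhs_right_lt.
apply: (@le_trans _ _ (c * t `^ d)); first by near: t.
rewrite ler_pM2l //.
by apply: ger_powR; rewrite // t0 ltW.
Unshelve. all: by end_near. Qed.

Lemma bO0 a b d : bO d (fun=> 0 : 'M[K]_(a, b)).
Proof. by exists 0; near=> t; rewrite nrm0 mul0r. Unshelve. all: by end_near. Qed.

Lemma bO_const a b (A : 'M[K]_(a, b)) : bO 0 (fun=> A).
Proof.
by exists (nrm A); near=> t; rewrite powRr0 mulr1.
Unshelve. all: by end_near. Qed.

Lemma bO_add a b d (A B : R -> 'M[K]_(a, b)) :
  bO d A -> bO d B -> bO d (fun t => A t + B t).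
Proof.
move=> [x Ax] [y By]; exists (x + y); near=> t.
by apply: le_trans (ler_nrmD mod _ _) _; rewrite mulrDl lerD //; near: t.
Unshelve. all: by end_near. Qed.

Lemma bO_opp a b d (A : R -> 'M[K]_(a, b)) : bO d A -> bO d (fun t => - A t).
Proof.
by move=> [x Ax]; exists x; near=> t; rewrite nrmN; near: t.
Unshelve. all: by end_near. Qed.

Lemma bO_sum a b d (I : Type) (r : seq I) (F : I -> R -> 'M[K]_(a, b)) :
  (forall i, bO d (F i)) -> bO d (fun t => \sum_(i <- r) F i t).
Proof.
move=> FO; elim: r => [|i r IHr].
  by apply: bO_ext (@bO0 _ _ _) => t; rewrite big_nil.
by apply: bO_ext (bO_add (FO i) IHr) => t; rewrite big_cons.
Qed.

Lemma bO_mul a b c d d' (A : R -> 'M[K]_(a, b)) (B : R -> 'M[K]_(b, c)) :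
  bO d A -> bO d' B -> bO (d + d') (fun t => A t *m B t).
Proof.
move=> /bO_pos[x x0 Ax] /bO_pos[y y0 By]; exists (x * y); near=> t.
have t0 : 0 < t by near: t; apply: near_pos.
apply: le_trans (ler_nrmM mod _ _) _.
rewrite powRD; last by rewrite (gt_eqF t0) implybT.
rewrite mulrACA; apply: ler_pM; rewrite ?nrm_ge0 //; by near: t.
Unshelve. all: by end_near. Qed.

Lemma bO_mull a b c d (A : 'M[K]_(a, b)) (B : R -> 'M[K]_(b, c)) :
  bO d B -> bO d (fun t => A *m B t).
Proof. by move=> /(bO_mul (bO_const A)); rewrite add0r. Qed.

Lemma bO_mulr a b c d (A : R -> 'M[K]_(a, b)) (B : 'M[K]_(b, c)) :
  bO d A -> bO d (fun t => A t *m B).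
Proof. by move=> /bO_mul/(_ (bO_const B)); rewrite addr0. Qed.

Lemma bO_adj a b d (A : R -> 'M[K]_(a, b)) : bO d A -> bO d (fun t => (A t)^t*).
Proof.
by move=> [x Ax]; exists x; near=> t; rewrite nrm_adj; near: t.
Unshelve. all: by end_near. Qed.

Lemma bO_powR a b d d' (A : R -> 'M[K]_(a, b)) :
  bO d' A -> bO (d + d') (fun t => of_real mod (t `^ d) *: A t).
Proof.
move=> [x Ax]; exists x; near=> t.
have t0 : 0 < t by near: t; apply: near_pos.
rewrite nrmZ md_real ?powR_ge0 // powRD; last by rewrite (gt_eqF t0) implybT.
by rewrite mulrCA ler_wpM2l ?powR_ge0 //; near: t.
Unshelve. all: by end_near. Qed.

Definition tends a b d (A : R -> 'M[K]_(a, b)) (A0 : 'M[K]_(a, b)) : Prop :=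
  bO d (fun t => A t - A0).

Lemma tends_ext a b d (A B : R -> 'M[K]_(a, b)) A0 :
  A =1 B -> tends d B A0 -> tends d A A0.
Proof. by move=> AB; apply: bO_ext => t; rewrite AB. Qed.

Lemma tends_const a b d (A : 'M[K]_(a, b)) : tends d (fun=> A) A.
Proof. by apply: bO_ext (@bO0 _ _ _) => t; rewrite subrr. Qed.

Lemma tends_bO a b d (A : R -> 'M[K]_(a, b)) A0 :
  0 <= d -> tends d A A0 -> bO 0 A.
Proof.
move=> d0 /(bO_le d0)/bO_add/(_ (bO_const A0)); apply: bO_ext => t.
by rewrite subrK.
Qed.

Lemma tends_add a b d (A B : R -> 'M[K]_(a, b)) A0 B0 :
  tends d A A0 -> tends d B B0 -> tends d (fun t => A t + B t) (A0 + B0).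
Proof.
move=> AO BO; apply: bO_ext (bO_add AO BO) => t.
by rewrite opprD addrACA.
Qed.

Lemma tends_opp a b d (A : R -> 'M[K]_(a, b)) A0 :
  tends d A A0 -> tends d (fun t => - A t) (- A0).
Proof. by move=> AO; apply: bO_ext (bO_opp AO) => t; rewrite opprD. Qed.

Lemma tends_sub a b d (A B : R -> 'M[K]_(a, b)) A0 B0 :
  tends d A A0 -> tends d B B0 -> tends d (fun t => A t - B t) (A0 - B0).
Proof. by move=> AO /tends_opp; apply: tends_add. Qed.

Lemma tends_mul a b c d (A : R -> 'M[K]_(a, b)) (B : R -> 'M[K]_(b, c)) A0 B0 :
  0 <= d -> tends d A A0 -> tends d B B0 ->
  tends d (fun t => A t *m B t) (A0 *m B0).
Proof.
move=> d0 AO BO; have := bO_mul AO (tends_bO d0 BO); rewrite addr0.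
move=> /bO_add/(_ (bO_mull A0 BO)); apply: bO_ext => t.
by rewrite mulmxBl mulmxBr addrA subrK.
Qed.

Lemma tends_adj a b d (A : R -> 'M[K]_(a, b)) A0 :
  tends d A A0 -> tends d (fun t => (A t)^t*) (A0^t*).
Proof.
by move=> AO; apply: bO_ext (bO_adj AO) => t; rewrite linearB /= map_mxB.
Qed.

Lemma bO_mxsub a b p q d (f : 'I_p -> 'I_a) (g : 'I_q -> 'I_b)
    (A : R -> 'M[K]_(a, b)) : bO d A -> bO d (fun t => mxsub f g (A t)).
Proof.
move=> [x Ax]; exists ((x *+ q) *+ p); near=> t.
have le_x i j : md mod (mxsub f g (A t) i j) <= x * t `^ d.
  by rewrite mxE; apply: le_trans (nrm_entry mod _ _ _) _; near: t.
rewrite mulrnAl -[X in _ *+ X]card_ord -sumr_const; apply: ler_sum => i _.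
by rewrite mulrnAl -[X in _ *+ X]card_ord -sumr_const; apply: ler_sum.
Unshelve. all: by end_near. Qed.

Lemma tends_mxsub a b p q d (f : 'I_p -> 'I_a) (g : 'I_q -> 'I_b)
    (A : R -> 'M[K]_(a, b)) A0 :
  tends d A A0 -> tends d (fun t => mxsub f g (A t)) (mxsub f g A0).
Proof.
by move=> /(bO_mxsub f g); apply: bO_ext => t; apply/matrixP => i j; rewrite !mxE.
Qed.

(** On the ball of radius 2 c t^d the Lipschitz constant c (t^d + r) is itself O(t^d), hence at most
    1/2 for small t. Two solutions of order t^d lie in a common ball of this kind, so their distance
    is at most half of itself. *)
Lemma small_fixpoint a b d (Phi : R -> 'M[K]_(a, b) -> 'M[K]_(a, b)) (c : R) :
  0 < d -> 0 < c ->
  (\forall t \near 0^'+, nrm (Phi t 0) <= c * t `^ d) ->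
  (\forall t \near 0^'+, forall r X Y, nrm X <= r -> nrm Y <= r ->
     nrm (Phi t X - Phi t Y) <= c * (t `^ d + r) * nrm (X - Y)) ->
  (exists2 H, bO d H & \forall t \near 0^'+, Phi t (H t) = H t) /\
  (forall H1 H2, bO d H1 -> bO d H2 ->
     (\forall t \near 0^'+, Phi t (H1 t) = H1 t) ->
     (\forall t \near 0^'+, Phi t (H2 t) = H2 t) ->
     \forall t \near 0^'+, H1 t = H2 t).
Proof.
move=> d0 c0 Phi0 PhiL.
have small k : 0 < k -> \forall t \near 0^'+, c * (t `^ d + k * t `^ d) <= 1 / 2.
  move=> k0; have e0 : 0 < (c * (1 + k) * 2)^-1.
    by rewrite invr_gt0 !mulr_gt0 // addr_gt0.
  near=> t; have te : t `^ d <= (c * (1 + k) * 2)^-1.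
    by near: t; apply: near_powR_le.
  have q0 : 0 < c * (1 + k) by rewrite mulr_gt0 // addr_gt0.
  rewrite -{1}[t `^ d]mul1r -mulrDl mulrA -ler_pdivlMl //.
  by apply: le_trans te _; rewrite invfM mul1r.
split.
  pose good t H := nrm H <= c * 2 * t `^ d /\ Phi t H = H.
  (* A fixed point is chosen for each [t] separately; 0 is the default where the ball contains
     none. *)
  pose H t := if pselect (exists H, good t H) is left e then projT1 (cid e) else 0.
  have goodH : \forall t \near 0^'+, good t (H t).
    near=> t; suff ex : exists H, good t H.
      by rewrite /H; case: pselect => // e; apply: (projT2 (cid e)).
    have [||X Xr XE] := @contraction_fixpoint R K mod a b (Phi t) (c * 2 * t `^ d).
    - suff -> : c * 2 * t `^ d / 2 = c * t `^ d by near: t.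
      by rewrite mulrAC mulfK ?pnatr_eq0.
    - move=> X Y Xr Yr.
      apply: (@le_trans _ _ (c * (t `^ d + c * 2 * t `^ d) * nrm (X - Y))).
        by move: X Y Xr Yr; near: t; apply: filterS PhiL => t tL X Y; apply: tL.
      rewrite [leRHS]mulrC ler_wpM2r ?nrm_ge0 // -[leRHS]mul1r.
      by near: t; apply: small; rewrite mulr_gt0.
    by exists X; split.
  by exists H; [exists (c * 2); apply: filterS goodH => t [] |
                apply: filterS goodH => t []].
move=> H1 H2 /bO_pos[x x0 H1x] /bO_pos[y y0 H2y] eq1 eq2.
near=> t; have E1 : Phi t (H1 t) = H1 t by near: t.
have E2 : Phi t (H2 t) = H2 t by near: t.
have t0 : 0 < t by near: t; apply: near_pos.
have L : nrm (Phi t (H1 t) - Phi t (H2 t)) <=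
    c * (t `^ d + (x + y) * t `^ d) * nrm (H1 t - H2 t).
  have B1 : nrm (H1 t) <= (x + y) * t `^ d.
    apply: (@le_trans _ _ (x * t `^ d)); first by near: t.
    by rewrite ler_wpM2r ?powR_ge0 // lerDl ltW.
  have B2 : nrm (H2 t) <= (x + y) * t `^ d.
    apply: (@le_trans _ _ (y * t `^ d)); first by near: t.
    by rewrite ler_wpM2r ?powR_ge0 // lerDr ltW.
  move: (H1 t) (H2 t) B1 B2; near: t; apply: filterS PhiL => t tL X Y; exact: tL.
rewrite E1 E2 in L; apply/eqP; rewrite -subr_eq0; apply/eqP/nrm_eq0.
have : nrm (H1 t - H2 t) <= 1 / 2 * nrm (H1 t - H2 t).
  apply: le_trans L _; rewrite ler_wpM2r ?nrm_ge0 //.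
  by near: t; apply: small; rewrite addr_gt0.
lra.
Unshelve. all: by end_near. Qed.

Lemma nrm_mxvec a b (A : 'M[K]_(a, b)) : nrm (mxvec A) = nrm A.
Proof.
rewrite /nrm big_ord1 pair_bigA (reindex _ (curry_mxvec_bij a b)) /=.
by apply: eq_bigr => -[i j] _; rewrite mxvecE.
Qed.

Lemma sylvester_inverse a b (A0 M0 : 'M[K]_a) (T0 : 'M[K]_b) :
  (forall H, A0 *m H = M0 *m H *m T0 -> H = 0) ->
  exists Linv : 'M[K]_(a, b) -> 'M[K]_(a, b),
    [/\ exists2 k, 0 < k & forall X, nrm (Linv X) <= k * nrm X,
        forall X Y, Linv (X - Y) = Linv X - Linv Y &
        forall X H, Linv X = H <-> A0 *m H - M0 *m H *m T0 = X].
Proof.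
move=> /sylvester_matrix[L Lu LE].
exists (fun X => vec_mx (mxvec X *m invmx L)); split.
- exists (nrm (invmx L) + 1); first by rewrite ltr_wpDl ?nrm_ge0.
  move=> X; rewrite -nrm_mxvec vec_mxK; apply: le_trans (ler_nrmM mod _ _) _.
  by rewrite nrm_mxvec mulrC ler_wpM2r ?nrm_ge0 // lerDl.
- by move=> X Y; rewrite linearB mulmxBl linearB.
- move=> X H; split=> [<-|<-].
    by apply: (can_inj mxvecK); rewrite -LE vec_mxK mulmxKV.
  by rewrite -LE mulmxK // mxvecK.
Qed.

(* Inverting the linearization at t = 0 turns the equation into a fixed point
   problem for a contraction of a ball of radius O(t^d). *)
Lemma quadratic_perturbation a b d (A M : R -> 'M[K]_a) (T : R -> 'M[K]_b)
    (Q : R -> 'M[K]_(b, a)) (c : R -> 'M[K]_(a, b)) A0 M0 T0 Q0 :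
  0 < d -> tends d A A0 -> tends d M M0 -> tends d T T0 -> tends d Q Q0 ->
  bO d c -> (forall H, A0 *m H = M0 *m H *m T0 -> H = 0) ->
  let solves H := \forall t \near 0^'+,
    A t *m H t + c t = M t *m H t *m (T t + Q t *m H t) in
  (exists2 H, bO d H & solves H) /\
  (forall H1 H2, bO d H1 -> bO d H2 -> solves H1 -> solves H2 ->
     \forall t \near 0^'+, H1 t = H2 t).
Proof.
move=> d0 AO MO TO QO cO inj0 solves.
have [Linv [[k k0 Lk] LB LE]] := sylvester_inverse inj0.
(* Everything except the linear part at t = 0 is moved to one side; fixed points of [Linv] after
   [Psi] are the solutions. *)
pose Psi t H := M t *m H *m (T t + Q t *m H) - M0 *m H *m T0
                - (A t - A0) *m H - c t.
pose Phi t H := Linv (Psi t H).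
have PhiE t H : Phi t H = H <->
    A t *m H + c t = M t *m H *m (T t + Q t *m H).
  rewrite /Phi LE /Psi mulmxBl; set X := M t *m H *m _.
  by split=> /eqP; rewrite -subr_eq0 => /eqP E; apply/eqP;
    rewrite -subr_eq0 -E; apply/eqP; mx_abel.
have bnd p q (X : R -> 'M[K]_(p, q)) e : 0 <= e -> bO e X ->
    exists2 x, 0 <= x & \forall t \near 0^'+, nrm (X t) <= x * t `^ e.
  by move=> _ /bO_pos[x /ltW]; exists x.
have [xA xA0 AB] := bnd _ _ _ _ (ltW d0) AO.
have [xM xM0 MB] := bnd _ _ _ _ (ltW d0) MO.
have [xT xT0 TB] := bnd _ _ _ _ (ltW d0) TO.
have [xc xc0 cB] := bnd _ _ _ _ (ltW d0) cO.
have [yM yM0 MB'] := bnd _ _ _ _ (lexx 0) (tends_bO (ltW d0) MO).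
have [yT yT0 TB'] := bnd _ _ _ _ (lexx 0) (tends_bO (ltW d0) TO).
have [yQ yQ0 QB'] := bnd _ _ _ _ (lexx 0) (tends_bO (ltW d0) QO).
pose m0 := nrm M0; have m00 : 0 <= m0 := nrm_ge0 mod _.
(* Collects the constants of the estimates below. The factor 2 comes from the two terms in the
   difference of the quadratic parts; adding 1 makes the constant positive. *)
pose c1 := k * (xA + xM * yT + m0 * xT + yM * yQ * 2 + xc) + 1.
have Psi0 t : Psi t 0 = - c t by rewrite /Psi !(mulmx0, mul0mx) !subr0 sub0r.
have PsiB t X Y : Psi t X - Psi t Y =
    (M t - M0) *m (X - Y) *m T t + M0 *m (X - Y) *m (T t - T0)
    - (A t - A0) *m (X - Y)
    + (M t *m ((X - Y) *m Q t *m X) + M t *m (Y *m Q t *m (X - Y))).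
  by rewrite /Psi; mx_ring.
have c10 : 0 < c1.
  by rewrite ltr_wpDl // mulr_ge0 ?(ltW k0) // !addr_ge0 // !mulr_ge0.
have [||ex un] := @small_fixpoint a b d Phi c1 d0 c10.
- near=> t; rewrite /Phi Psi0; apply: le_trans (Lk _) _; rewrite nrmN.
  apply: (@le_trans _ _ (k * (xc * t `^ d))).
    by rewrite ler_pM2l //; near: t.
  rewrite mulrA ler_wpM2r ?powR_ge0 // /c1 ler_wpDr // ler_pM2l // lerDr.
  by rewrite !addr_ge0 // !mulr_ge0.
- near=> t => r X Y Xr Yr; rewrite /Phi -LB; apply: le_trans (Lk _) _.
  have e0 : 0 <= t `^ d := powR_ge0 _ _.
  have r0 : 0 <= r := le_trans (nrm_ge0 mod _) Xr.
  set z := nrm (X - Y); have z0 : 0 <= z := nrm_ge0 mod _.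
  have hA : nrm (A t - A0) <= xA * t `^ d by near: t.
  have hM : nrm (M t - M0) <= xM * t `^ d by near: t.
  have hT : nrm (T t - T0) <= xT * t `^ d by near: t.
  have hM' : nrm (M t) <= yM.
    by rewrite -[leRHS]mulr1 -(powRr0 t); near: t.
  have hT' : nrm (T t) <= yT.
    by rewrite -[leRHS]mulr1 -(powRr0 t); near: t.
  have hQ' : nrm (Q t) <= yQ.
    by rewrite -[leRHS]mulr1 -(powRr0 t); near: t.
  have mul3 p q u v (P1 : 'M[K]_(p, q)) (P2 : 'M[K]_(q, u))
      (P3 : 'M[K]_(u, v)) x1 x2 x3 :
      nrm P1 <= x1 -> nrm P2 <= x2 -> nrm P3 <= x3 ->
      nrm (P1 *m P2 *m P3) <= x1 * x2 * x3.
    move=> h1 h2 h3; apply: le_trans (ler_nrmM mod _ _) _.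
    rewrite ler_pM ?nrm_ge0 //; apply: le_trans (ler_nrmM mod _ _) _.
    by rewrite ler_pM ?nrm_ge0.
  have lezz : nrm (X - Y) <= z by [].
  have b1 := mul3 _ _ _ _ _ _ _ _ _ _ hM lezz hT'.
  have b2 := mul3 _ _ _ _ _ _ _ _ _ _ (lexx (nrm M0)) lezz hT.
  have b3 : nrm ((A t - A0) *m (X - Y)) <= xA * t `^ d * z.
    by apply: le_trans (ler_nrmM mod _ _) _; rewrite ler_pM ?nrm_ge0.
  have b4 : nrm (M t *m ((X - Y) *m Q t *m X)) <= yM * (z * yQ * r).
    apply: le_trans (ler_nrmM mod _ _) _; rewrite ler_pM ?nrm_ge0 //.
    exact: mul3.
  have b5 : nrm (M t *m (Y *m Q t *m (X - Y))) <= yM * (r * yQ * z).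
    apply: le_trans (ler_nrmM mod _ _) _; rewrite ler_pM ?nrm_ge0 //.
    exact: mul3.
  apply: (@le_trans _ _ (k * (xM * t `^ d * z * yT + m0 * z * (xT * t `^ d)
      + xA * t `^ d * z + (yM * (z * yQ * r) + yM * (r * yQ * z))))).
    rewrite ler_pM2l // PsiB; apply: le_trans (ler_nrmD mod _ _) _; apply: lerD.
      apply: le_trans (ler_nrmB mod _ _) _; apply: lerD => //.
      by apply: le_trans (ler_nrmD mod _ _) _; apply: lerD.
    by apply: le_trans (ler_nrmD mod _ _) _; apply: lerD.
  (* The gap between the two bounds is written as a sum of products of nonnegative factors. *)
  rewrite -subr_ge0 (_ : _ - _ =
     (k * ((xA + xM * yT + m0 * xT) * r + yM * yQ * 2 * t `^ d
       + xc * (t `^ d + r)) + (t `^ d + r)) * z); last by rewrite /c1; ring.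
  rewrite mulr_ge0 // addr_ge0 ?addr_ge0 // mulr_ge0 ?(ltW k0) //.
  by rewrite !addr_ge0 ?mulr_ge0 ?addr_ge0 ?mulr_ge0.
split.
  by case: ex => H HO HE; exists H => //; apply: filterS HE => t /PhiE.
by move=> H1 H2 O1 O2 s1 s2; apply: un => //;
  [apply: filterS s1|apply: filterS s2] => t /PhiE.
Unshelve. all: by end_near. Qed.

End Asymptotic.

Lemma bO_bigO (R : realType) a b d (A : R -> 'M[R[i]]_(a, b)) :
  bO (complex_modulus R) d A -> bigO_t d A.
Proof.
case=> c Ac; exists c; near=> t; apply: le_trans (mx_norm_le_nrm _) _.
by rewrite /tpow -rmorphM lecR; near: t.
Unshelve. all: by end_near. Qed.

(** * Spectra, normalization and invariant subspaces *)

Section Spectrum.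
Variable K : numClosedFieldType.

Lemma char_poly_ublock a b (A : 'M[K]_a) (X : 'M[K]_(a, b)) (B : 'M[K]_b) :
  char_poly (block_mx A X 0 B) = char_poly A * char_poly B.
Proof.
rewrite /char_poly /char_poly_mx map_block_mx scalar_mx_block opp_block_mx.
by rewrite add_block_mx raddf0 oppr0 addr0 det_ublock.
Qed.

Lemma char_poly_similar a (M A B : 'M[K]_a) :
  M \in unitmx -> A *m M = M *m B -> char_poly A = char_poly B.
Proof.
move=> Mu AM; rewrite /char_poly.
pose M' := map_mx polyC M; have M'u : M' \in unitmx.
  by rewrite unitmxE det_map_mx rmorph_unit -?unitmxE.
have : char_poly_mx A *m M' = M' *m char_poly_mx B.
  by rewrite mulmxBl mulmxBr -!map_mxM AM scalar_mxC.
move=> /(congr1 determinant); rewrite !det_mulmx mulrC => /mulfI; apply.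
by move: M'u; rewrite unitmxE; apply: contraTneq => ->; rewrite unitr0.
Qed.

Lemma char_poly_spectrum a (A : 'M[K]_a) :
  char_poly A = \prod_(z <- sval (closed_field_poly_normal (char_poly A)))
                   ('X - z%:P).
Proof.
case: closed_field_poly_normal => r /= {1}->.
by rewrite (monicP (char_poly_monic A)) scale1r.
Qed.

Lemma spectrumE a (A : 'M[K]_a) z : spectrum A z = mup z (char_poly A).
Proof. by rewrite mset_seqE -mu_prod_XsubC -char_poly_spectrum. Qed.

Lemma spectrum_root a (A : 'M[K]_a) z :
  (z \in spectrum A) = root (char_poly A) z.
Proof.
rewrite in_mset spectrumE -XsubC_dvd ?monic_neq0 ?char_poly_monic //.
by rewrite dvdp_XsubCl.
Qed.

Lemma notin_spectrum_unit a (A : 'M[K]_a) z :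
  z \notin spectrum A -> A - z%:M \in unitmx.
Proof.
rewrite spectrum_root -eigenvalue_root_char /eigenvalue negbK => /eqP E0.
rewrite -row_free_unit; apply: inj_row_free => v /sub_kermxP.
by rewrite -[kermx _]/(eigenspace A z) E0 submx0 => /eqP.
Qed.

(** H intertwines every polynomial in A with the same polynomial in B. A Bezout identity for the
    coprime characteristic polynomials, evaluated at A and applied to H, vanishes term by term by
    Cayley-Hamilton. *)
Lemma intertwiner_eq0 a b (A : 'M[K]_a) (B : 'M[K]_b) (H : 'M[K]_(a, b)) :
  (forall z, root (char_poly A) z -> ~~ root (char_poly B) z) ->
  A *m H = H *m B -> H = 0.
Proof.
case: a A H => [|a] A H; first by move=> _ _; rewrite [H]flatmx0.
case: b B H => [|b] B H; first by move=> _ _; rewrite [H]thinmx0.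
move=> disj AH.
have hornerH p : horner_mx A p *m H = H *m horner_mx B p.
  elim/poly_ind: p => [|p c IHp]; first by rewrite !rmorph0 mul0mx mulmx0.
  rewrite !(rmorphD, rmorphM) /= !(horner_mx_X, horner_mx_C) mulmxDl mulmxDr.
  by rewrite -mulmxA AH mulmxA IHp -mulmxA scalar_mxC.
have /Bezout_eq1_coprimepP[[u v] /= uv] : coprimep (char_poly A) (char_poly B).
  by apply: Pdiv.ClosedField.root_coprimep => z /disj.
rewrite -[H]mul1mx -[1%:M]/(1 : 'M[K]_a.+1) -(rmorph1 (horner_mx A)) -uv.
rewrite rmorphD !rmorphM /= mulmxDl Cayley_Hamilton mulr0 mul0mx add0r.
by rewrite -mulmxA hornerH Cayley_Hamilton !mulmx0.
Qed.

(** In the factorization of F through its column and row bases, the invertible row factor is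
    absorbed into the leading block. *)
Lemma full_rank_complete l r (F : 'M[K]_(l + r, l)) : \rank F = l ->
  exists2 M, M \in unitmx & M *m col_mx 1%:M 0 = F.
Proof.
move=> rF; exists (col_ebase F *m block_mx (row_ebase F) 0 0 1%:M).
  rewrite unitmx_mul col_ebase_unit unitmxE det_ublock det1 mulr1 -unitmxE.
  exact: row_ebase_unit.
rewrite -mulmxA mul_block_col !mulmx1 !mulmx0 !addr0.
rewrite -{3}[F]mulmx_ebase -mulmxA; congr (_ *m _).
rewrite rF; have -> : pid_mx l = col_mx 1%:M 0 :> 'M[K]_(l + r, l).
  by rewrite pid_mx_col.
by rewrite mul_col_mx mul1mx mul0mx.
Qed.

Lemma scalar_add_block a b (al : K) (A : 'M[K]_a) (B : 'M[K]_b) :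
  al%:M + block_mx A 0 0 (B - al%:M) = block_mx (al%:M + A) 0 0 B.
Proof.
rewrite scalar_mx_block add_block_mx !addr0.
by rewrite [X in block_mx _ _ _ X]addrC subrK.
Qed.

End Spectrum.

Section Adjoint.
Variable K : numClosedFieldType.

Lemma adjM a b c (A : 'M[K]_(a, b)) (B : 'M[K]_(b, c)) :
  (A *m B)^t* = B^t* *m A^t*.
Proof. by rewrite trmx_mul map_mxM. Qed.

Lemma adjD a b (A B : 'M[K]_(a, b)) : (A + B)^t* = A^t* + B^t*.
Proof. by rewrite linearD map_mxD. Qed.

Lemma adj1 a : (1%:M : 'M[K]_a)^t* = 1%:M.
Proof. by rewrite trmx1 map_mx1. Qed.

Lemma adj_inv a (A : 'M[K]_a) : (invmx A)^t* = invmx (A^t*).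
Proof. by rewrite trmx_inv map_invmx. Qed.

Lemma hermsymmx_adj a (A : 'M[K]_a) : A \is hermsymmx -> A^t* = A.
Proof. by move=> Ah; rewrite [RHS](is_hermitianmxP _ _ _ Ah) expr0 scale1r. Qed.

(** T' is the adjoint of T for the form L, and L^-1 G is self-adjoint for that form; the equation is
    palindromic, so taking adjoints preserves it. *)
Lemma adjoint_solution a (L G T : 'M[K]_a) :
  L \in unitmx -> L^t* = L -> G^t* = G -> T *m (invmx L *m G) *m T = 1%:M ->
  let T' := invmx L *m T^t* *m L in T' *m (invmx L *m G) *m T' = 1%:M.
Proof.
move=> Lu Lh Gh TGT.
have E : T^t* *m (G *m invmx L) *m T^t* = 1%:M.
  by rewrite -[RHS]adj1 -TGT !adjM adj_inv Lh Gh !mulmxA.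
move=> T'; suff -> : T' *m (invmx L *m G) *m T' =
    invmx L *m (T^t* *m (G *m invmx L) *m T^t*) *m L by rewrite E mulmx1 mulVmx.
by rewrite /T' !mulmxA mulmxK.
Qed.

(** With N = L^-1 G: T^* G T = T^* L N T = L T N T = L. *)
Lemma congruence_of_selfadjoint a (L G T : 'M[K]_a) :
  L \in unitmx -> T *m (invmx L *m G) *m T = 1%:M -> T^t* *m L = L *m T ->
  T^t* *m G *m T = L.
Proof.
move=> Lu TGT TL; rewrite -{1}[G](mulKVmx Lu) [T^t* *m _]mulmxA TL.
by rewrite -!(mulmxA L) TGT mulmx1.
Qed.

(** Brings T N T = 1 with T = 1 + X into the form required by [quadratic_perturbation]. *)
Lemma shifted_square_eq a (N X : 'M[K]_a) :
  N *m X + (N - 1%:M) = - 1%:M *m X *m (N + N *m X) <->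
  (1%:M + X) *m N *m (1%:M + X) = 1%:M.
Proof.
rewrite mulNmx mul1mx.
by split=> /eqP; rewrite -subr_eq0 => /eqP E; apply/eqP;
  rewrite -subr_eq0 -E; apply/eqP;
  rewrite ?(mulmxDl, mulmxDr, mul1mx, mulmx1); mx_ring.
Qed.

Lemma selfadjoint_commute a (L T : 'M[K]_a) : L \in unitmx ->
  T = invmx L *m T^t* *m L -> T^t* *m L = L *m T.
Proof. by move=> Lu {2}->; rewrite !mulmxA mulmxV // mul1mx. Qed.

End Adjoint.

Section Perturbation.
Variables (R : realType) (K : numClosedFieldType) (mod : modulus R K).
Local Notation bO := (bO mod).
Local Notation tends := (tends mod).

(* T solves T (Lam^-1 G) T = 1 near the identity; Lam^-1 T^* Lam is another small
   solution, so by uniqueness T^* Lam = Lam T, whence T^* G T = Lam. *)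
Lemma perturbed_normalization a d (Lam : 'M[K]_a) (G : R -> 'M[K]_a) :
  0 < d -> Lam \in unitmx -> Lam^t* = Lam -> tends d G Lam ->
  (\forall t \near 0^'+, (G t)^t* = G t) ->
  exists T Ti : R -> 'M[K]_a, [/\ tends d T 1%:M, tends d Ti 1%:M &
    \forall t \near 0^'+,
      [/\ (T t)^t* *m G t *m T t = Lam, T t *m Ti t = 1%:M &
          Ti t *m T t = 1%:M]].
Proof.
move=> d0 Lu Lh GL Gh; pose N t := invmx Lam *m G t.
have NO : tends d N 1%:M.
  by rewrite -(mulVmx Lu); apply: tends_mul (ltW d0) (tends_const _ _ _) GL.
have cO : bO d (fun t => N t - 1%:M) by [].
(* At t = 0 the linearization of T N T is H |-> 2 H. *)
have inj1 (H : 'M[K]_a) : 1%:M *m H = (- 1%:M) *m H *m 1%:M -> H = 0.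
  rewrite mul1mx mulNmx mul1mx mulmx1 => /eqP; rewrite -subr_eq0 opprK -mulr2n.
  rewrite -scaler_nat scaler_eq0 pnatr_eq0 /=.
  by move/eqP.
have [[H HO Heq] Hun] := quadratic_perturbation d0 NO
   (tends_const mod d (- 1%:M)) NO NO cO inj1.
pose H' t := invmx Lam *m (H t)^t* *m Lam.
have H'O : bO d H' by apply/bO_mulr/bO_mull/bO_adj.
have T'E t : 1%:M + H' t = invmx Lam *m (1%:M + H t)^t* *m Lam.
  by rewrite adjD adj1 mulmxDr mulmxDl mulmx1 mulVmx.
have H'eq : \forall t \near 0^'+,
    N t *m H' t + (N t - 1%:M) = - 1%:M *m H' t *m (N t + N t *m H' t).
  apply: filterS2 Heq Gh => t /shifted_square_eq TNT Gt.
  by apply/shifted_square_eq; rewrite T'E; apply: adjoint_solution.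
have HH' := Hun _ _ HO H'O Heq H'eq.
(* T N T = 1 exhibits N T as the inverse of T, so the limit of the inverse is that of a product. *)
exists (fun t => 1%:M + H t), (fun t => N t *m (1%:M + H t)).
have TO : tends d (fun t => 1%:M + H t) 1%:M.
  by apply: bO_ext HO => t; rewrite addrAC subrr add0r.
split=> //.
  by rewrite -[X in tends d _ X]mulmx1; apply: tends_mul (ltW d0) NO TO.
apply: filterS2 Heq HH' => t /shifted_square_eq TNT HH't.
split; last 2 first.
- by rewrite mulmxA.
- by apply: mulmx1C; rewrite mulmxA.
apply: (congruence_of_selfadjoint Lu TNT (selfadjoint_commute Lu _)).
exact: etrans (congr1 (+%R 1%:M) HH't) (T'E t).
Qed.

(* In a basis extending F, the perturbed subspace is the graph of the solution of
   a Riccati equation whose linear part is a Sylvester operator. *)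
Lemma invariant_subspace_perturbation b l d (S : 'M[K]_b) (F : 'M[K]_(b, l))
    (Om : 'M[K]_l) (St : R -> 'M[K]_b) :
  0 < d -> \rank F = l -> S *m F = F *m Om ->
  (spectrum Om `&` (spectrum S `\` spectrum Om) = mset0)%mset ->
  tends d St S ->
  exists Ft Ot, [/\ tends d Ft F, tends d Ot Om &
    \forall t \near 0^'+, St t *m Ft t = Ft t *m Ot t].
Proof.
move=> d0 rF SF disj SO.
have le_lb : (l <= b)%N by rewrite -rF rank_leq_row.
have eb : b = (l + (b - l))%N by rewrite subnKC.
move: (b - l)%N eb => r eb; subst b => {le_lb}.
have [M Mu MF] := full_rank_complete rF.
pose S1 := invmx M *m S *m M.
have S1E : S1 = block_mx Om (ursubmx S1) 0 (drsubmx S1).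
  (* Invariance of the range of F makes S block triangular in the completed basis. *)
  have S1c : S1 *m col_mx 1%:M 0 = col_mx Om 0.
    rewrite /S1 -!mulmxA MF SF -MF -!mulmxA mulKmx //.
    by rewrite mul_col_mx mul1mx mul0mx.
  move: S1c; rewrite -{1 2}[S1]submxK mul_block_col !mulmx0 !mulmx1 !addr0.
  by case/eq_col_mx=> -> ->.
set S12 := ursubmx S1 in S1E; set S22 := drsubmx S1 in S1E.
have charS : char_poly S = char_poly Om * char_poly S22.
  rewrite -(char_poly_ublock _ S12) -S1E; apply: (char_poly_similar Mu).
  by rewrite /S1 -mulmxA mulKVmx.
(* A common eigenvalue of Om and S22 has larger multiplicity in S than in Om, so it survives in the
   multiset difference and violates the gap. *)
have inj0 (H : 'M[K]_(r, l)) : S22 *m H = 1%:M *m H *m Om -> H = 0.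
  rewrite mul1mx; apply: intertwiner_eq0 => z z22; apply/negP => zOm.
  move/msetP/(_ z): disj; rewrite mset0E msetE2 => /eqP; apply/negP.
  rewrite -lt0n leq_min -in_mset spectrum_root zOm /=.
  rewrite msetE2 subn_gt0 !spectrumE charS.
  rewrite mupM ?monic_neq0 ?char_poly_monic // -[X in (X < _)%N]addn0 ltn_add2l.
  by rewrite -XsubC_dvd ?monic_neq0 ?char_poly_monic // dvdp_XsubCl.
pose X t := invmx M *m St t *m M.
have XO : tends d X S1.
  by apply: tends_mul (ltW d0) (tends_mul (ltW d0) _ SO) _; apply: tends_const.
have ulO : tends d (fun t => ulsubmx (X t)) Om.
  rewrite -(block_mxKul Om S12 0 S22) -S1E ulsubmxEsub.
  by apply: tends_ext (tends_mxsub _ _ XO) => t; rewrite ulsubmxEsub.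
have urO : tends d (fun t => ursubmx (X t)) S12.
  rewrite /S12 ursubmxEsub.
  by apply: tends_ext (tends_mxsub _ _ XO) => t; rewrite ursubmxEsub.
have drO : tends d (fun t => drsubmx (X t)) S22.
  rewrite /S22 drsubmxEsub.
  by apply: tends_ext (tends_mxsub _ _ XO) => t; rewrite drsubmxEsub.
have dlO : bO d (fun t => dlsubmx (X t)).
  apply: bO_ext (tends_mxsub (@rshift l r) (@lshift l r) XO) => t.
  by rewrite -!dlsubmxEsub S1E block_mxKdl subr0.
have [[H HO Heq] _] := quadratic_perturbation d0 drO (tends_const mod d 1%:M) ulO
   urO dlO inj0.
pose Y t : 'M[K]_(l + r, l) := col_mx 1%:M (H t).
have YO : tends d Y (col_mx 1%:M 0).
  apply: bO_ext (bO_mull (col_mx 0 1%:M) HO) => t.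
  by rewrite /Y opp_col_mx add_col_mx subrr subr0 mul_col_mx mul0mx mul1mx.
exists (fun t => M *m Y t), (fun t => ulsubmx (X t) + ursubmx (X t) *m H t).
split.
- by rewrite -MF; apply: tends_mul (ltW d0) (tends_const _ _ _) YO.
- rewrite -[X in tends d _ X]addr0 -[X in _ + X](mulmx0 l S12).
  apply: tends_add ulO (tends_mul (ltW d0) urO _).
  by apply: bO_ext HO => t; rewrite subr0.
apply: filterS Heq => t; rewrite mul1mx addrC => E.
have XY : X t *m Y t = Y t *m (ulsubmx (X t) + ursubmx (X t) *m H t).
  rewrite -{1}(submxK (X t)) /Y mul_block_col !mulmx1 E mul_col_mx.
  by rewrite mul1mx.
by rewrite -[RHS]mulmxA -XY /X -!mulmxA mulKVmx.
Qed.

End Perturbation.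

(** * Selecting the blocks of the Jordan basis *)

Section Selectors.
Variable K : numClosedFieldType.

(* Block row i (0-based) of a block column; 0 when i is out of range. *)
Definition blksel (k r i : nat) : 'M[K]_(r, \sum_(j < k) r) :=
  \mxrow_(j < k) (if i == j :> nat then 1%:M else 0).

Lemma blksel_mxcol k r b (Y : 'I_k -> 'M[K]_(r, b)) i (ik : (i < k)%N) :
  blksel k r i *m \mxcol_j Y j = Y (Ordinal ik).
Proof.
rewrite mul_mxrow_mxcol (bigD1 (Ordinal ik)) //= eqxx mul1mx big1 ?addr0 //.
by move=> j ij; rewrite eq_sym (val_eqE j (Ordinal ik)) (negbTE ij) mul0mx.
Qed.

Lemma submxcol_blksel k r b (Y : 'M[K]_(\sum_(j < k) r, b)) (j : 'I_k) :
  submxcol Y j = blksel k r j *m Y.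
Proof. by case: j => i ik; rewrite -{2}[Y]submxcolK blksel_mxcol. Qed.

Lemma blksel_ext k r b (Y Z : 'M[K]_(\sum_(j < k) r, b)) :
  (forall i, (i < k)%N -> blksel k r i *m Y = blksel k r i *m Z) -> Y = Z.
Proof.
move=> YZ; apply/mxcolP => j; rewrite !submxcol_blksel; exact: YZ.
Qed.

Lemma blksel_out k r i : (k <= i)%N -> blksel k r i = 0.
Proof.
move=> ki; rewrite -[RHS]mxrow0; apply/eq_mxrow => j.
by rewrite gtn_eqF // (leq_trans (ltn_ord j)).
Qed.

Lemma blksel_mxblock k r (B : 'I_k -> 'I_k -> 'M[K]_r) i (ik : (i < k)%N) :
  blksel k r i *m \mxblock_(j, l) B j l = \mxrow_l B (Ordinal ik) l.
Proof. by rewrite mxblockEv blksel_mxcol. Qed.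

Lemma mul_blksel k r i c (S : 'M[K]_(c, r)) :
  S *m blksel k r i = \mxrow_(j < k) (if i == j :> nat then S else 0).
Proof.
rewrite mul_mxrow; apply/eq_mxrow => j.
by case: eqP; rewrite ?mulmx1 ?mulmx0.
Qed.

(** The last row is no exception: the selector beyond the range is 0, like the last block row of the
    shift. *)
Lemma blksel_shift k r i : blksel k r i *m shift_block K k r = blksel k r i.+1.
Proof.
have [ki|ik] := leqP k i; first by rewrite !blksel_out ?mul0mx // leqW.
rewrite blksel_mxblock; apply/eq_mxrow => j /=.
by rewrite eq_sym.
Qed.

Lemma blksel_antidiag k r i (S : 'M[K]_r) : (i < k)%N ->
  blksel k r i *m antidiag_block k S = S *m blksel k r (k - i.+1).
Proof.
move=> ik; rewrite blksel_mxblock mul_blksel.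
apply/eq_mxrow => j /=; congr (if _ then _ else _); apply/eqP/eqP; lia.
Qed.

Lemma blksel_Theta k r i (S : 'M[K]_r) : (i < k)%N ->
  blksel k r i *m Theta k S =
  if i.+1 == k then S *m blksel k r 0 else blksel k r i.+1.
Proof.
move=> ik; rewrite blksel_mxblock /=.
have [ek|nk] := eqVneq i.+1 k; rewrite ?mul_blksel; apply/eq_mxrow => j /=.
  by rewrite ek (ltn_eqF (ltn_ord j)) eq_sym.
by rewrite eq_sym.
Qed.

Lemma blksel_mxdiag k r (B : 'I_k -> 'M[K]_r) i (ik : (i < k)%N) :
  blksel k r i *m \mxdiag_j B j = B (Ordinal ik) *m blksel k r i.
Proof.
rewrite mul_mxrow_mxdiag mul_blksel; apply/eq_mxrow => j.
case: eqP => [e|_]; last by rewrite mul0mx.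
by rewrite mul1mx; congr B; apply: val_inj.
Qed.

Lemma scale_expmx l (x : K) (A : 'M[K]_l) j : (x *: A) ^+ j = x ^+ j *: A ^+ j.
Proof.
elim: j => [|j IHj]; first by rewrite !expr0 scale1r.
rewrite !exprS IHj -[_ * _]/(_ *m _) -[A * _]/(A *m _).
by rewrite -scalemxAl -scalemxAr scalerA.
Qed.

Lemma conj_blksel k r i : map_mx Num.conj (blksel k r i) = blksel k r i.
Proof.
apply/matrixP => a c; rewrite !mxE.
by case: ifP => _; rewrite !mxE ?rmorph_nat ?rmorph0.
Qed.

Lemma blksel_orth k r i j : (i < k)%N -> (j < k)%N ->
  blksel k r i *m (blksel k r j)^T = if i == j then 1%:M else 0.
Proof.
move=> ik jk; rewrite tr_mxrow blksel_mxcol /= eq_sym.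
by case: eqP; rewrite ?trmx1 ?trmx0.
Qed.

Section TopLevel.
Variables (m : nat) (s : nat -> nat) (q : nat).
Local Notation n := (total_size m s + q)%N.

(* The rows of the k-th Jordan group (1-based); 0 when k is out of range. *)
Definition topsel (k : nat) : 'M[K]_(\sum_(i < k) s k, n) :=
  row_mx (\mxrow_(j < m) (if j.+1 == k
    then conform_mx 0 (1%:M : 'M[K]_(\sum_(i < k) s k)) else 0)) 0.

(** Locked so that rewriting and unification treat a selector as an atom. *)
Definition Sel (k i : nat) : 'M[K]_(s k, n) :=
  locked (blksel k (s k) i *m topsel k).

Lemma SelE k i : Sel k i = blksel k (s k) i *m topsel k.
Proof. by rewrite /Sel -lock. Qed.

Definition SelC : 'M[K]_(q, n) := row_mx 0 1%:M.

Lemma topsel_col b (Y : forall j : 'I_m, 'M[K]_(\sum_(i < j.+1) s j.+1, b))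
    (Z : 'M[K]_(q, b)) (j : 'I_m) :
  topsel j.+1 *m col_mx (\mxcol_i Y i) Z = Y j.
Proof.
rewrite mul_row_col mul0mx addr0 mul_mxrow_mxcol (bigD1 j) //= eqxx.
(* [conform_mx] only bridges the types indexed by k and by [j.+1]; on the surviving summand it is
   the identity. *)
rewrite conform_mx_id mul1mx [X in _ + X]big1 ?addr0 // => i ij.
by rewrite eqSS (val_eqE i j) (negbTE ij) mul0mx.
Qed.

Lemma SelC_col b (Y : 'M[K]_(total_size m s, b)) (Z : 'M[K]_(q, b)) :
  SelC *m col_mx Y Z = Z.
Proof. by rewrite mul_row_col mul0mx add0r mul1mx. Qed.

Lemma topsel_submxcol b (Y : 'M[K]_(n, b)) (j : 'I_m) :
  topsel j.+1 *m Y = submxcol (usubmx Y) j.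
Proof.
have := @topsel_col b (fun i => submxcol (usubmx Y) i) (dsubmx Y) j.
by rewrite submxcolK vsubmxK.
Qed.

Lemma SelC_dsubmx b (Y : 'M[K]_(n, b)) : SelC *m Y = dsubmx Y.
Proof. by rewrite -{1}[Y]vsubmxK SelC_col. Qed.

Definition assemble b (f : forall k i : nat, 'M[K]_(s k, b)) (g : 'M[K]_(q, b)) :
    'M[K]_(n, b) :=
  col_mx (\mxcol_(j < m) \mxcol_(i < j.+1) f j.+1 i) g.

Lemma Sel_assemble b (f : forall k i : nat, 'M[K]_(s k, b)) g k i :
  (1 <= k <= m)%N -> (i < k)%N -> Sel k i *m assemble f g = f k i.
Proof.
case: k => // k /= km ik; rewrite SelE -mulmxA.
rewrite (topsel_col (fun j : 'I_m => \mxcol_(i < j.+1) f j.+1 i) g (Ordinal km)).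
by rewrite blksel_mxcol.
Qed.

Lemma SelC_assemble b (f : forall k i : nat, 'M[K]_(s k, b)) g :
  SelC *m assemble f g = g.
Proof. exact: SelC_col. Qed.

(** Together with [Sel_assemble] this reduces identities between matrices given by [assemble] to
    their block rows. *)
Lemma Sel_ext b (Y Z : 'M[K]_(n, b)) :
  (forall k i, (1 <= k <= m)%N -> (i < k)%N -> Sel k i *m Y = Sel k i *m Z) ->
  SelC *m Y = SelC *m Z -> Y = Z.
Proof.
move=> YZ YZC; rewrite -[Y]vsubmxK -[Z]vsubmxK -!SelC_dsubmx YZC.
congr col_mx; apply/mxcolP => j; rewrite -!topsel_submxcol.
by apply: blksel_ext => i ij; rewrite !mulmxA -!SelE; apply: YZ => //=.
Qed.

Lemma Sel_out k i : (k <= i)%N -> Sel k i = 0.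
Proof. by move=> ki; rewrite SelE blksel_out ?mul0mx. Qed.

(** Selectors have entries 0 and 1, so their adjoint is their transpose. *)
Lemma conj_topsel k : map_mx Num.conj (topsel k) = topsel k.
Proof.
rewrite map_row_mx map_mx0; congr row_mx; apply/matrixP => a c; rewrite !mxE.
move: (tagnat.sig1 c) (tagnat.sig2 c) => j x; case: eqP => [e|_]; last first.
  by rewrite !mxE rmorph0.
by subst k; rewrite conform_mx_id !mxE rmorph_nat.
Qed.

Lemma conj_Sel k i : map_mx Num.conj (Sel k i) = Sel k i.
Proof. by rewrite SelE map_mxM conj_blksel conj_topsel. Qed.

Lemma conj_SelC : map_mx Num.conj SelC = SelC.
Proof. by rewrite map_row_mx map_mx0 map_mx1. Qed.

Lemma topsel_tr (k k' : nat) :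
  topsel k *m (topsel k')^T =
  \sum_(j < m) (if j.+1 == k then conform_mx 0 (1%:M : 'M[K]_(\sum_(i < k) s k))
      else 0 : 'M[K]_(_, \sum_(i < j.+1) s j.+1)) *m
    (if j.+1 == k' then conform_mx 0 (1%:M : 'M[K]_(\sum_(i < k') s k'))
      else 0 : 'M[K]_(_, \sum_(i < j.+1) s j.+1))^T.
Proof.
rewrite tr_row_mx mul_row_col trmx0 mulmx0 addr0 tr_mxrow mul_mxrow_mxcol.
by [].
Qed.

Lemma topsel_trK k : (1 <= k <= m)%N -> topsel k *m (topsel k)^T = 1%:M.
Proof.
case: k => // k /= km; rewrite topsel_tr (bigD1 (Ordinal km)) //= eqxx.
rewrite conform_mx_id trmx1 mul1mx [X in _ + X]big1 ?addr0 // => j jk.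
by rewrite eqSS (val_eqE j (Ordinal km)) (negbTE jk) mul0mx.
Qed.

Lemma topsel_tr0 k k' : k != k' -> topsel k *m (topsel k')^T = 0.
Proof.
move=> kk'; rewrite topsel_tr; apply: big1 => j _.
case: eqP => [->|_]; last by rewrite mul0mx.
by rewrite (negbTE kk') trmx0 mulmx0.
Qed.

Lemma topsel_SelC_tr k : topsel k *m SelC^T = 0.
Proof. by rewrite tr_row_mx mul_row_col trmx0 mulmx0 mul0mx addr0. Qed.

Lemma SelC_topsel_tr k : SelC *m (topsel k)^T = 0.
Proof. by rewrite -[LHS]trmxK trmx_mul trmxK topsel_SelC_tr trmx0. Qed.

Lemma Sel_topsel_tr k i : (1 <= k <= m)%N ->
  Sel k i *m (topsel k)^T = blksel k (s k) i.
Proof. by move=> km; rewrite SelE -mulmxA topsel_trK ?mulmx1. Qed.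

Lemma Sel_topsel_tr0 k k' i : k != k' -> Sel k i *m (topsel k')^T = 0.
Proof. by move=> kk'; rewrite SelE -mulmxA topsel_tr0 ?mulmx0. Qed.

Lemma topsel_mxdiag k (B : forall k, 'M[K]_(\sum_(i < k) s k)) (X : 'M[K]_q) :
  topsel k *m block_mx (\mxdiag_(j < m) B j.+1) 0 0 X = B k *m topsel k.
Proof.
rewrite mul_row_block !mul0mx !mulmx0 !addr0 mul_mx_row mulmx0.
congr row_mx; rewrite mul_mxrow_mxdiag mul_mxrow; apply/eq_mxrow => j.
case: eqP => [e|_]; last by rewrite mul0mx mulmx0.
by subst k; rewrite conform_mx_id mulmx1 mul1mx.
Qed.

Lemma Sel_Nmx k i (X : 'M[K]_q) :
  Sel k i *m block_mx (Nmx K m s) 0 0 X = Sel k i.+1.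
Proof.
by rewrite !SelE -mulmxA (topsel_mxdiag k (fun k => shift_block K k (s k))) mulmxA
  blksel_shift.
Qed.

Lemma Sel_DeltaT k i tau (X : 'M[K]_q) : (i < k)%N ->
  Sel k i *m block_mx (DeltaT K m s tau) 0 0 X =
  signature K (s k) (tau k) *m Sel k (k - i.+1).
Proof.
move=> ik; rewrite !SelE -mulmxA (topsel_mxdiag k (fun k => Gammamx K s tau k)).
by rewrite mulmxA blksel_antidiag // -!mulmxA.
Qed.

Lemma SelC_block (Y : 'M[K]_(total_size m s)) (X : 'M[K]_q) :
  SelC *m block_mx Y 0 0 X = X *m SelC.
Proof.
by rewrite mul_row_block !mul0mx !mulmx0 !add0r mul1mx mul_mx_row mulmx0 mulmx1.
Qed.

Section Basis.
Variables (U : forall k i : nat, 'M[K]_(n, s k)) (UC : 'M[K]_(n, q)).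
Local Notation V := (row_mx (UT m U) UC).

Lemma basis_topsel_tr k : (1 <= k <= m)%N -> V *m (topsel k)^T = Ublock U k.
Proof.
case: k => // k /= km; rewrite tr_row_mx mul_row_col trmx0 mulmx0 addr0.
rewrite tr_mxrow mul_mxrow_mxcol (bigD1 (Ordinal km)) //= eqxx.
rewrite conform_mx_id trmx1 mulmx1 [X in _ + X]big1 ?addr0 // => j jk.
rewrite eqSS (val_eqE j (Ordinal km)) (negbTE jk) trmx0 mulmx0 //.
Qed.

Lemma basis_Sel_tr k i : (1 <= k <= m)%N -> (i < k)%N ->
  V *m (Sel k i)^T = U k i.+1.
Proof.
move=> km ik; rewrite SelE trmx_mul mulmxA basis_topsel_tr // tr_mxrow.
rewrite mul_mxrow_mxcol.
rewrite (bigD1 (Ordinal ik)) //= eqxx trmx1 mulmx1.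
rewrite [X in _ + X]big1 ?addr0 // => j jk.
by rewrite (val_eqE (Ordinal ik) j) eq_sym (negbTE jk) trmx0 mulmx0.
Qed.

Lemma Sel_adj_basis k i : (1 <= k <= m)%N -> (i < k)%N ->
  Sel k i *m V^t* = (U k i.+1)^t*.
Proof.
by move=> km ik; rewrite -basis_Sel_tr // adjM trmxK conj_Sel.
Qed.

Lemma basis_mul b (Y : 'M[K]_(n, b)) :
  V *m Y = \sum_(1 <= k < m.+1) Ublock U k *m (topsel k *m Y) + UC *m (SelC *m Y).
Proof.
rewrite SelC_dsubmx big_add1 /= big_mkord.
rewrite -{1}[Y]vsubmxK mul_row_col; congr (_ + _).
rewrite -[usubmx Y]submxcolK mul_mxrow_mxcol; apply: eq_bigr => j _.
by rewrite topsel_submxcol.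
Qed.

End Basis.
End TopLevel.
End Selectors.

(** * Leading Jordan vectors and the Schur complement *)

Section LeadingBlocks.
Variables (K : numClosedFieldType) (n : nat) (s : nat -> nat).
Variable U : forall k i : nat, 'M[K]_(n, s k).

(** Follows the recursion of [Emx], so that products with [Emx] become sums over the same list. *)
Fixpoint colstack b (js : seq nat) (f : forall k, 'M[K]_(s k, b)) :
    'M[K]_(width s js, b) :=
  if js is j :: js' return 'M[K]_(width s js, b)
  then col_mx (f j) (colstack js' f) else 0.

Lemma Emx_colstack b js (f : forall k, 'M[K]_(s k, b)) :
  Emx U js *m colstack js f = \sum_(k <- js) U k 1 *m f k.
Proof.
elim: js => [|j js IHjs] /=; first by rewrite big_nil mulmx0.
by rewrite mul_row_col IHjs big_cons.
Qed.

Lemma adj_Emx_mul b js (Y : 'M[K]_(n, b)) :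
  (Emx U js)^t* *m Y = colstack js (fun k => (U k 1)^t* *m Y).
Proof.
elim: js => [|j js IHjs] /=; first by rewrite [LHS]flatmx0.
by rewrite tr_row_mx map_col_mx mul_col_mx IHjs.
Qed.

Lemma colstack_inj b js (f g : forall k, 'M[K]_(s k, b)) :
  colstack js f = colstack js g -> forall k, k \in js -> f k = g k.
Proof.
elim: js => //= j js IHjs /eq_col_mx[fj /IHjs fjs] k.
by rewrite inE => /orP[/eqP->|/fjs].
Qed.

Lemma eq_colstack b js (f g : forall k, 'M[K]_(s k, b)) :
  (forall k, k \in js -> f k = g k) -> colstack js f = colstack js g.
Proof.
elim: js => //= j js IHjs fg; rewrite fg ?mem_head // IHjs // => k kjs.
by rewrite fg // inE kjs orbT.
Qed.

Lemma colstack0 b js : colstack js (fun k => 0 : 'M[K]_(s k, b)) = 0.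
Proof. by elim: js => //= j js ->; rewrite col_mx0. Qed.

Lemma unitmx_of_injective a (A : 'M[K]_a) :
  (forall b (X : 'M[K]_(a, b)), A *m X = 0 -> X = 0) -> A \in unitmx.
Proof.
move=> inj; rewrite -unitmx_tr -row_free_unit; apply: inj_row_free => v vA.
by apply: trmx_inj; rewrite trmx0; apply: inj; rewrite -[A]trmxK -trmx_mul vA trmx0.
Qed.

Variables (m : nat) (tau : nat -> nat) (Delta D : 'M[K]_n).

Lemma from_cons k : (k <= m)%N -> from m k = k :: from m k.+1.
Proof. by move=> km; rewrite /from /index_iota subSS subSn. Qed.

Lemma from_nil : from m m.+1 = [::].
Proof. by rewrite /from /index_iota subnn. Qed.

Lemma mem_from k j : (j \in from m k) = (k <= j <= m)%N.
Proof. by rewrite mem_index_iota. Qed.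

Hypothesis W_unit : forall k : nat, (1 <= k <= m)%N ->
  Wmx tau U Delta D (from m k) \in unitmx.

Lemma What_unit k : (1 <= k <= m.+1)%N ->
  What U Delta D (from m k) \in unitmx.
Proof.
case/andP=> k1; rewrite leq_eqVlt => /orP[/eqP->|km].
  (* For k = m + 1 the matrix is empty and has determinant 1. *)
  by rewrite from_nil; rewrite unitmxE det_mx00 unitr1.
have := W_unit (_ : (1 <= k <= m)%N); rewrite k1 => /(_ km).
by rewrite /Wmx unitmx_mul => /andP[].
Qed.

Variable rho : nat.
Hypothesis rho_m : (1 <= rho <= m)%N.
Local Notation js := (from m rho.+1).
Local Notation G := (Gmx m U Delta D rho).

(** The conditions are the block rows of a linear system with matrix What_(rho+1), whose solution
    defines G_rho. *)
Lemma colstack_eq_G b (y : 'M[K]_(s rho, b)) (f : forall k, 'M[K]_(s k, b)) :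
  (forall k, (rho < k <= m)%N -> (U k 1)^t* *m Delta *m D *m
     (U rho 1 *m y + \sum_(k' <- js) U k' 1 *m f k') = 0) ->
  colstack js f = G *m y.
Proof.
move=> Uf0; have Wu : What U Delta D js \in unitmx.
  by apply: What_unit; case/andP: rho_m.
have : (Emx U js)^t* *m (Delta *m (D *m
    (U rho 1 *m y + Emx U js *m colstack js f))) = 0.
  rewrite adj_Emx_mul -[RHS](colstack0 b js); apply: eq_colstack => k.
  by rewrite mem_from Emx_colstack => /Uf0; rewrite !mulmxA.
rewrite !mulmxDr !mulmxA -[X in _ + X *m _]/(What U Delta D js) => /eqP.
rewrite addr_eq0 => /eqP E.
rewrite /Gmx mulNmx -(mulmxA (invmx _)) E mulmxN opprK.
by rewrite mulKmx.
Qed.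

Lemma Erho_IG b (y : 'M[K]_(s rho, b)) :
  Erho m U rho *m (IG m U Delta D rho *m y) =
  U rho 1 *m y + Emx U js *m (G *m y).
Proof. by rewrite mul_col_mx mul1mx mul_row_col. Qed.

Lemma IG0E : IG0 m U Delta D rho = IG m U Delta D rho *m blksel K rho (s rho) 0.
Proof. by rewrite mul_blksel; apply/eq_mxrow => j; rewrite eq_sym. Qed.

Lemma Smx_mul b (y : 'M[K]_(s rho, b)) :
  Smx m tau U Delta D rho *m y =
  signature K (s rho) (tau rho) *m ((U rho 1)^t* *m Delta *m D *m
     (U rho 1 *m y + Emx U js *m (G *m y))).
Proof. by rewrite /Smx !(mulmxDr, mulmxDl) !mulmxA. Qed.

Lemma signatureK r a : signature K r a *m signature K r a = 1%:M.
Proof.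
apply/matrixP => i j; rewrite mul_diag_mx !mxE.
by case: eqP => _; case: ifP => _;
  rewrite ?mulr1n ?mulr0n ?mulr0 ?mulr1 ?mulrNN ?mulr1.
Qed.

Lemma signature_adj r a : (signature K r a)^t* = signature K r a.
Proof.
rewrite tr_diag_mx map_diag_mx; congr diag_mx; apply/rowP => i; rewrite !mxE.
by case: ifP; rewrite ?rmorphN rmorph1.
Qed.

(* S_rho is, up to a signature, the Schur complement of What_(rho+1) in
   What_rho. *)
Lemma Smx_unit : Smx m tau U Delta D rho \in unitmx.
Proof.
have /andP[rho1 rhom] := rho_m.
apply: unitmx_of_injective => b y; rewrite Smx_mul.
move/(congr1 (mulmx (signature K (s rho) (tau rho)))).
rewrite mulmxA signatureK mul1mx mulmx0 => Sy.
have Wu : What U Delta D (from m rho) \in unitmx.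
  by apply: What_unit; rewrite rho1 leqW.
have WG : (Emx U js)^t* *m Delta *m D *m
    (U rho 1 *m y + Emx U js *m (G *m y)) = 0.
  have Wu' : What U Delta D js \in unitmx by apply: What_unit.
  rewrite mulmxDr (mulmxA _ (Emx U js)) -[_ *m Emx U js]/(What U Delta D js).
  by rewrite /Gmx mulNmx mulmxN -(mulmxA (invmx _)) mulKVmx // mulmxA subrr.
move: Wu; rewrite from_cons // => Wu.
have : What U Delta D (rho :: js) *m col_mx y (G *m y) = 0.
  rewrite /What /= tr_row_mx map_col_mx !mul_col_mx -!(mulmxA _ (row_mx _ _)).
  by rewrite mul_row_col Sy WG col_mx0.
move/(congr1 (mulmx (invmx (What U Delta D (rho :: js))))).
rewrite mulKmx // mulmx0 -[0]col_mx0.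
by case/eq_col_mx.
Qed.

End LeadingBlocks.

(** * Canonical forms and companion matrices *)

Section Canonical.
Variable K : numClosedFieldType.

Lemma antidiag_blockK k r (S : 'M[K]_r) : S *m S = 1%:M ->
  antidiag_block k S *m antidiag_block k S = 1%:M.
Proof.
move=> SS; apply: blksel_ext => i ik.
rewrite mulmxA blksel_antidiag // -mulmxA blksel_antidiag; last by lia.
rewrite mulmxA SS mul1mx mulmx1; congr blksel; lia.
Qed.

Lemma antidiag_block_adj k r (S : 'M[K]_r) : S^t* = S ->
  (antidiag_block k S)^t* = antidiag_block k S.
Proof.
move=> Sh; rewrite tr_mxblock; apply/matrixP => i j; rewrite !mxE addnC.
case: ifP => _; last by rewrite !mxE rmorph0.
by rewrite -[in RHS]Sh !mxE.
Qed.

Lemma canonical_form_sqr l (L : 'M[K]_l) : canonical_form L -> L *m L = 1%:M.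
Proof.
case=> q d B Bc; rewrite /mxdiag mul_mxdiag_mxblock.
rewrite -[RHS]mxdiagZ; apply: eq_mxblock => i j.
have BB : B i *m B i = 1%:M.
  case: (Bc i) => [r|k a b k0]; last by rewrite antidiag_blockK ?signatureK.
  rewrite mulmx_block !(mul0mx, mulmx0, mul1mx, mulmx1, addr0, add0r).
  by rewrite -scalar_mx_block.
case: eqP => [<-|_]; last by rewrite mulmx0.
by rewrite !conform_mx_id.
Qed.

Lemma canonical_form_unit l (L : 'M[K]_l) : canonical_form L -> L \in unitmx.
Proof. by move=> /canonical_form_sqr/mulmx1_unit[]. Qed.

Lemma Gammamx_unit s tau k : Gammamx K s tau k \in unitmx.
Proof.
by have /mulmx1_unit[] := antidiag_blockK k (signatureK K (s k) (tau k)).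
Qed.

Lemma Gammamx_adj s tau k : (Gammamx K s tau k)^t* = Gammamx K s tau k.
Proof. exact: antidiag_block_adj (signature_adj _ _ _). Qed.

(** Block companion structure: the last row of Theta X = 0 gives the first block of X through S, and
    the other rows are shifted blocks of X. *)
Lemma Theta_unit k r (S : 'M[K]_r) : S \in unitmx -> Theta k S \in unitmx.
Proof.
move=> Su; apply: unitmx_of_injective => b X TX.
apply: blksel_ext => i ik; rewrite mulmx0.
case: i ik => [|i] ik.
  have := congr1 (mulmx (blksel K k r k.-1)) TX.
  rewrite mulmxA blksel_Theta; last by lia.
  rewrite prednK // eqxx mulmx0 => /(congr1 (mulmx (invmx S))).
  by rewrite mulmx0 -mulmxA mulKmx.
have := congr1 (mulmx (blksel K k r i)) TX.
rewrite mulmxA blksel_Theta; last by lia.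
by rewrite (ltn_eqF ik) mulmx0.
Qed.

End Canonical.

(** * The scaled pencil *)

Section Pencil.
Variable K : numClosedFieldType.
Variables (m : nat) (s tau : nat -> nat) (q rho : nat).
Hypothesis rho_m : (1 <= rho <= m)%N.
Local Notation n := (total_size m s + q)%N.
Local Notation Sel := (Sel K m s q).
Local Notation SelC := (SelC K m s q).
Local Notation topsel := (topsel K m s q).
Local Notation blk := (blksel K rho (s rho)).
Local Notation assemble := (assemble m).

(** The product vanishes unless (k, i) = (k', i'), and then the coefficients agree. *)
Lemma Sel_orth (c : nat -> nat -> K) k i k' i' :
  (1 <= k <= m)%N -> (i < k)%N -> (i' < k')%N ->
  c k i *: (Sel k i *m (Sel k' i')^T) = c k' i' *: (Sel k i *m (Sel k' i')^T).
Proof.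
move=> km ik ik'; rewrite [Sel k' i']SelE trmx_mul mulmxA.
have [e|kk'] := eqVneq k k'; last by rewrite Sel_topsel_tr0 // mul0mx !scaler0.
subst k'; rewrite Sel_topsel_tr // blksel_orth //.
by case: eqP => [->//|_]; rewrite !scaler0.
Qed.

Lemma Sel_SelC_tr k i : Sel k i *m SelC^T = 0.
Proof. by rewrite SelE -mulmxA topsel_SelC_tr mulmx0. Qed.

Lemma SelC_Sel_tr k i : SelC *m (Sel k i)^T = 0.
Proof. by rewrite -[LHS]trmxK trmx_mul trmxK Sel_SelC_tr trmx0. Qed.

(* With eps = t^(1/rho), block row k, i (k 1-based, i 0-based) of the perturbed
   basis, in coordinates with respect to U, is of order eps ^ wexp k i; the
   coordinates in U_C are of order eps ^ rho. *)
Definition wexp (k i : nat) : nat :=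
  if (k <= rho)%N then (rho - k + i)%N else minn i rho.

Definition Dw (e : K) : 'M[K]_n :=
  assemble (fun k i => e ^+ wexp k i *: Sel k i) (e ^+ rho *: SelC).

Lemma Sel_Dw e k i : (1 <= k <= m)%N ->
  Sel k i *m Dw e = e ^+ wexp k i *: Sel k i.
Proof.
move=> km; have [ki|ik] := leqP k i; last by rewrite Sel_assemble.
by rewrite Sel_out // mul0mx scaler0.
Qed.

Lemma SelC_Dw e : SelC *m Dw e = e ^+ rho *: SelC.
Proof. exact: SelC_assemble. Qed.

(** [Dw] is diagonal but defined by its rows; its action on columns is recovered from the
    orthogonality of the selectors. *)
Lemma Dw_tr e : (Dw e)^T = Dw e.
Proof.
have DS k i : (1 <= k <= m)%N -> (i < k)%N ->
    Dw e *m (Sel k i)^T = e ^+ wexp k i *: (Sel k i)^T.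
  move=> km ik; apply: Sel_ext => [k' i' km' ik'|].
    rewrite mulmxA Sel_Dw // -scalemxAl -scalemxAr.
    exact: (Sel_orth (fun k i => e ^+ wexp k i)).
  by rewrite mulmxA SelC_Dw -scalemxAl -scalemxAr SelC_Sel_tr !scaler0.
have DSC : Dw e *m SelC^T = e ^+ rho *: SelC^T.
  apply: Sel_ext => [k i km ik|].
    by rewrite mulmxA Sel_Dw // -scalemxAl -scalemxAr Sel_SelC_tr !scaler0.
  by rewrite mulmxA SelC_Dw -scalemxAl -scalemxAr.
apply: Sel_ext => [k i km ik|].
  by apply: trmx_inj; rewrite trmx_mul trmxK DS // Sel_Dw // linearZ.
by apply: trmx_inj; rewrite trmx_mul trmxK DSC SelC_Dw linearZ.
Qed.

Lemma Dw_adj e : Num.conj e = e -> (Dw e)^t* = Dw e.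
Proof.
move=> ee; rewrite Dw_tr; apply: Sel_ext => [k i km ik|].
  rewrite -[X in X *m _ = _]conj_Sel -map_mxM Sel_Dw // map_mxZ conj_Sel.
  by rewrite rmorphXn /= ee.
rewrite -[X in X *m _ = _]conj_SelC -map_mxM SelC_Dw map_mxZ conj_SelC.
by rewrite rmorphXn /= ee.
Qed.

Section Gram.
Variable DeltaC : 'M[K]_q.
Local Notation J := (block_mx (DeltaT K m s tau) 0 0 DeltaC).

Definition Gram (e : K) : 'M[K]_n :=
  assemble (fun k i => e ^+ (wexp k i + wexp k (k - i.+1) - rho.-1) *:
              (signature K (s k) (tau k) *m Sel k (k - i.+1)))
           (e ^+ rho.+1 *: (DeltaC *m SelC)).

Lemma Gram_scaled e : Dw e *m J *m Dw e = e ^+ rho.-1 *: Gram e.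
Proof.
apply: Sel_ext => [k i km ik|].
  rewrite -scalemxAr Sel_assemble // !mulmxA Sel_Dw // -!scalemxAl.
  rewrite Sel_DeltaT // -mulmxA Sel_Dw // -scalemxAr !scalerA -!exprD.
  congr (_ ^+ _ *: _); rewrite /wexp.
  by case: (leqP k rho) => k_rho; lia.
rewrite -scalemxAr SelC_assemble !mulmxA SelC_Dw -!scalemxAl SelC_block.
rewrite -mulmxA SelC_Dw -scalemxAr !scalerA -!exprD; congr (_ ^+ _ *: _).
by move: rho_m; lia.
Qed.

(** The weights of paired rows sum to 2 rho - k - 1 for k <= rho and to at least rho for k > rho, so
    the exponent is 0 exactly for k = rho. *)
Lemma Gram0 : Gram 0 = (topsel rho)^T *m Gammamx K s tau rho *m topsel rho.
Proof.
apply: Sel_ext => [k i km ik|].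
  rewrite Sel_assemble // !mulmxA.
  have [ek|kr] := eqVneq k rho; last first.
    rewrite Sel_topsel_tr0 // !mul0mx expr0n [_ == 0%N](_ : _ = false) ?scale0r //.
    by apply/negbTE; rewrite /wexp; case: (leqP k rho) => ?; lia.
  move: i ik km; rewrite ek => i ik km.
  rewrite Sel_topsel_tr // blksel_antidiag // SelE mulmxA.
  rewrite [X in 0 ^+ X](_ : _ = 0%N) ?expr0 ?scale1r //.
  by rewrite /wexp leqnn; lia.
rewrite SelC_assemble expr0n scale0r !mulmxA.
by rewrite SelC_topsel_tr !mul0mx.
Qed.

End Gram.

Section Operators.
Variables (B : 'M[K]_n) (X : 'M[K]_q).
Local Notation A := (block_mx (Nmx K m s) 0 0 X).

(* Multiplied by e ^ wexp k i.+1 (and by e ^ rho in the U_C rows), the rows of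
   calA e and calM e become those of (A + e^rho B) (Dw e) and of e (Dw e).  After
   this division no negative power of e remains and e = 0 makes sense. *)
Definition calA (e : K) : 'M[K]_n :=
  assemble (fun k i => Sel k i.+1 +
      e ^+ (rho - wexp k i.+1) *: (Sel k i *m B *m Dw e))
    (X *m SelC + SelC *m B *m Dw e).

Definition calM (e : K) : 'M[K]_n :=
  assemble (fun k i => e ^+ ((wexp k i).+1 - wexp k i.+1) *: Sel k i) (e *: SelC).

(** This bound and the next make the truncated subtractions in [calA] and [calM] genuine
    differences. *)
Lemma wexp_le k i : (i < k)%N -> (wexp k i.+1 <= rho)%N.
Proof. by move=> ik; rewrite /wexp; case: (leqP k rho) => ?; lia. Qed.

Lemma wexpS_le k i : (wexp k i.+1 <= (wexp k i).+1)%N.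
Proof. by rewrite /wexp; case: (leqP k rho) => ?; lia. Qed.

Lemma pencil_scaled e b (Z : 'M[K]_(n, b)) (T : 'M[K]_b) :
  calA e *m Z = calM e *m Z *m T ->
  (A + e ^+ rho *: B) *m (Dw e *m Z) = e *: (Dw e *m Z *m T).
Proof.
move=> AZ; apply: Sel_ext => [k i km ik|].
  have := congr1 (mulmx (Sel k i)) AZ.
  rewrite /calA /calM !mulmxA !Sel_assemble // => E.
  rewrite mulmxDr Sel_Nmx -scalemxAr !mulmxDl -scalemxAr !mulmxA.
  rewrite !Sel_Dw // -!scalemxAl.
  move: E; rewrite mulmxDl -!scalemxAl => /(congr1 ( *:%R (e ^+ wexp k i.+1))).
  rewrite scalerDr !scalerA -!exprD (subnKC (wexp_le ik)) (subnKC (wexpS_le k i)).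
  by rewrite exprS.
have := congr1 (mulmx SelC) AZ.
rewrite /calA /calM !mulmxA !SelC_assemble => E.
rewrite mulmxDr SelC_block -scalemxAr !mulmxDl -scalemxAr !mulmxA SelC_Dw.
rewrite -(mulmxA X) SelC_Dw -scalemxAr -!scalemxAl.
move: E; rewrite mulmxDl -!scalemxAl => /(congr1 ( *:%R (e ^+ rho))).
by rewrite scalerDr !scalerA -exprSr exprS.
Qed.

(** In the rho-th group each step raises the weight by exactly 1. Hence, if P Z = 1, the rho-th rows
    of the equation read P calA Z = Theta, which eliminates Theta. *)
Lemma topsel_calM e : topsel rho *m calM e = topsel rho.
Proof.
apply: blksel_ext => i ik; rewrite mulmxA -SelE Sel_assemble //.
by rewrite /wexp leqnn subnn !add0n subnn expr0 scale1r.
Qed.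

End Operators.
End Pencil.

(** * The limit problem at t = 0 *)

Section LimitProblem.
Variable K : numClosedFieldType.
Variables (m : nat) (s tau : nat -> nat) (q rho : nat).
Hypothesis rho_m : (1 <= rho <= m)%N.
Local Notation n := (total_size m s + q)%N.
Local Notation Sel := (Sel K m s q).
Local Notation SelC := (SelC K m s q).
Local Notation P := (topsel K m s q rho).
Local Notation blk := (blksel K rho (s rho)).
Local Notation assemble := (assemble m).
Local Notation wexp := (wexp rho).

Variables (U : forall k i : nat, 'M[K]_(n, s k)) (UC : 'M[K]_(n, q)).
Local Notation V := (row_mx (UT m U) UC).
Variables (Delta D : 'M[K]_n) (DeltaC X : 'M[K]_q).
Hypothesis V_unit : V \in unitmx.
Hypothesis Gram_V : V^t* *m Delta *m V = block_mx (DeltaT K m s tau) 0 0 DeltaC.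
Hypothesis X_unit : X \in unitmx.
Hypothesis W_unit : forall k : nat, (1 <= k <= m)%N ->
  Wmx tau U Delta D (from m k) \in unitmx.

Local Notation B := (invmx V *m D *m V).
Local Notation D0 := (Dw m s q rho (0 : K)).
Local Notation A0 := (calA rho B X 0).
Local Notation M0 := (calM m s q rho (0 : K)).
Local Notation Gm := (Gmx m U Delta D rho).
Local Notation S := (Smx m tau U Delta D rho).

(** The Gram relation expresses V^-1 through V^* Delta, and the antidiagonal pairs the last row of a
    group with its first vector. *)
Lemma Sel_last_B k : (1 <= k <= m)%N ->
  Sel k k.-1 *m B =
  signature K (s k) (tau k) *m ((U k 1)^t* *m Delta *m D *m V).
Proof.
move=> km; have [k0 _] := andP km.
have E : Sel k k.-1 =
    signature K (s k) (tau k) *m (Sel k 0 *m (V^t* *m Delta *m V)).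
  by rewrite Gram_V Sel_DeltaT // mulmxA signatureK mul1mx subn1.
rewrite E -(Sel_adj_basis U UC) // !mulmxA; congr (_ *m _); congr (_ *m _).
by rewrite mulmxK.
Qed.

Lemma Ublock_mul k b (Y : 'M[K]_(\sum_(i < k) s k, b)) :
  Ublock U k *m Y = \sum_(i < k) U k i.+1 *m (blksel K k (s k) i *m Y).
Proof.
rewrite -{1}[Y]submxcolK mul_mxrow_mxcol; apply: eq_bigr => i _.
by rewrite submxcol_blksel.
Qed.

(** Only rows of weight 0 survive at e = 0: the first rows of the groups k >= rho. *)
Lemma basis_D0 b (Z : 'M[K]_(n, b)) : V *m (D0 *m Z) =
  U rho 1 *m (Sel rho 0 *m Z)
  + \sum_(k <- from m rho.+1) U k 1 *m (Sel k 0 *m Z).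
Proof.
have /andP[rho1 rhom] := rho_m.
rewrite basis_mul (mulmxA SelC) SelC_Dw -scalemxAl expr0n gtn_eqF //.
rewrite scale0r mulmx0 addr0.
have F k : (1 <= k <= m)%N -> Ublock U k *m (topsel K m s q k *m (D0 *m Z)) =
    if (rho <= k)%N then U k 1 *m (Sel k 0 *m Z) else 0.
  move=> km; rewrite Ublock_mul.
  have E i : blksel K k (s k) i *m (topsel K m s q k *m (D0 *m Z)) =
      0 ^+ wexp k i *: (Sel k i *m Z).
    by rewrite !mulmxA -SelE Sel_Dw // scalemxAl.
  under eq_bigr do rewrite E.
  have [rk|kr] := leqP rho k; last first.
    apply: big1 => i _; rewrite expr0n [_ == _](_ : _ = false) ?scale0r ?mulmx0 //.
    by apply/negbTE; rewrite /wexp (ltnW kr); lia.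
  have k0 : (0 < k)%N by case/andP: km.
  rewrite (bigD1 (Ordinal k0)) //= [X in _ + X]big1 ?addr0.
    have -> : wexp k 0 = 0%N by rewrite /wexp; case: (leqP k rho) => ?; lia.
    by rewrite expr0 scale1r.
  move=> i; rewrite -val_eqE /= => i0.
  rewrite expr0n [_ == _](_ : _ = false) ?scale0r ?mulmx0 //.
  by apply/negbTE; rewrite /wexp; case: (leqP k rho) => ?; lia.
rewrite (big_cat_nat (n := rho)) //=; last by rewrite leqW.
rewrite big_nat_cond big1 ?add0r; last first.
  move=> k; rewrite andbT => /andP[k1 kr]; rewrite F; last by rewrite k1; lia.
  by rewrite leqNgt kr.
rewrite big_ltn ?ltnS // F ?rho1 // leqnn; congr (_ + _).
rewrite /from big_nat_cond [RHS]big_nat_cond; apply: eq_bigr => k.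
rewrite andbT => /andP[rk km]; rewrite F; last by lia.
by rewrite ltnW.
Qed.

Lemma D0_eq0 b (H : 'M[K]_(n, b)) :
  (forall k, (rho <= k <= m)%N -> Sel k 0 *m H = 0) -> D0 *m H = 0.
Proof.
have /andP[rho1 rhom] := rho_m.
move=> H0; apply: Sel_ext => [k i km ik|]; rewrite mulmx0 mulmxA.
  rewrite Sel_Dw // -scalemxAl expr0n; case: eqP => w0; last by rewrite scale0r.
  have [-> rk] : i = 0%N /\ (rho <= k)%N.
    by move: w0; rewrite /wexp; case: (leqP k rho) => ?; split; lia.
  by rewrite H0 ?scaler0 // rk; case/andP: km.
by rewrite SelC_Dw -scalemxAl expr0n gtn_eqF // scale0r.
Qed.

(* For k > rho the last row of the limit equation degenerates to a linear
   condition on the first rows; it is the condition that produces G_rho. *)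
Lemma limit_first_rows b (H : 'M[K]_(n, b)) :
  (forall k, (rho < k <= m)%N -> Sel k k.-1 *m B *m D0 *m H = 0) ->
  colstack (from m rho.+1) (fun k => Sel k 0 *m H) = Gm *m (Sel rho 0 *m H).
Proof.
move=> last0; apply: (colstack_eq_G W_unit rho_m) => k rk.
have km : (1 <= k <= m)%N by lia.
rewrite -basis_D0 !mulmxA.
have := last0 k rk; rewrite Sel_last_B //.
move=> /(congr1 (mulmx (signature K (s k) (tau k)))).
by rewrite !mulmxA signatureK mul1mx mulmx0.
Qed.

Lemma limit_D0_eq0 b (H : 'M[K]_(n, b)) : P *m H = 0 ->
  (forall k, (rho < k <= m)%N -> Sel k k.-1 *m B *m D0 *m H = 0) ->
  D0 *m H = 0.
Proof.
move=> PH last0; apply: D0_eq0 => k /andP[rk km].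
have S0 : Sel rho 0 *m H = 0 by rewrite SelE -mulmxA PH mulmx0.
move: rk; rewrite leq_eqVlt => /orP[/eqP<-//|rk].
apply: (@colstack_inj _ s b (from m rho.+1) (fun k => Sel k 0 *m H) (fun=> 0)).
  by rewrite limit_first_rows // S0 mulmx0 colstack0.
by rewrite mem_from rk.
Qed.

Lemma Sel_A0 k i b (H : 'M[K]_(n, b)) : (1 <= k <= m)%N -> (i < k)%N ->
  Sel k i *m (A0 *m H) =
  Sel k i.+1 *m H + 0 ^+ (rho - wexp k i.+1) *: (Sel k i *m B *m D0 *m H).
Proof. by move=> km ik; rewrite mulmxA Sel_assemble // mulmxDl -scalemxAl. Qed.

Lemma Sel_M0 k i b (H : 'M[K]_(n, b)) : (1 <= k <= m)%N -> (i < k)%N ->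
  Sel k i *m (M0 *m H) =
  0 ^+ ((wexp k i).+1 - wexp k i.+1) *: (Sel k i *m H).
Proof. by move=> km ik; rewrite mulmxA Sel_assemble // -scalemxAl. Qed.

(** For k > rho the weight has already saturated at rho in the last row, so [calM] keeps a factor e
    there, while in [calA] the B term has exponent 0. *)
Lemma Sel_last_M0 k b (H : 'M[K]_(n, b)) : (rho < k <= m)%N ->
  Sel k k.-1 *m (M0 *m H) = 0.
Proof.
move=> rk; rewrite Sel_M0; [|lia..].
rewrite expr0n [_ == _](_ : _ = false) ?scale0r //.
by apply/negbTE; rewrite /wexp; case: (leqP k rho) => ?; lia.
Qed.

Lemma Sel_last_A0 k b (H : 'M[K]_(n, b)) : (rho < k <= m)%N ->
  Sel k k.-1 *m (A0 *m H) = Sel k k.-1 *m B *m D0 *m H.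
Proof.
move=> rk; rewrite Sel_A0; [|lia..].
rewrite Sel_out; last by lia.
rewrite mul0mx add0r (_ : rho - _ = 0)%N ?expr0 ?scale1r //.
by rewrite /wexp; case: (leqP k rho) => ?; lia.
Qed.

(** Once D0 H = 0, the B terms drop out and each row determines a neighbour. For k > rho zeros
    propagate upwards in i from the weight 0 row; for k < rho downwards from the row beyond the
    range, cancelling T; the U_C rows use X. *)
Lemma limit_unique b (H : 'M[K]_(n, b)) (T : 'M[K]_b) : T \in unitmx ->
  P *m H = 0 ->
  (forall k i, (1 <= k <= m)%N -> (i < k)%N -> k != rho ->
     Sel k i *m (A0 *m H) = Sel k i *m (M0 *m H *m T)) ->
  SelC *m (A0 *m H) = SelC *m (M0 *m H *m T) -> H = 0.
Proof.
move=> Tu PH HE HEC; have D0H : D0 *m H = 0.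
  apply: limit_D0_eq0 => // k rk; rewrite -Sel_last_A0 // HE; [|lia..].
  by rewrite -mulmxA Sel_last_M0.
have step k i : (1 <= k <= m)%N -> (i < k)%N -> k != rho ->
    Sel k i.+1 *m H =
    0 ^+ ((wexp k i).+1 - wexp k i.+1) *: (Sel k i *m H *m T).
  move=> km ik kr; have := HE k i km ik kr.
  rewrite Sel_A0 // -!(mulmxA _ D0) D0H mulmx0 scaler0 addr0 => ->.
  by rewrite mulmxA Sel_M0 // -scalemxAl.
apply: Sel_ext => [k i km ik|]; rewrite mulmx0; last first.
  apply: (can_inj (mulKmx X_unit)); rewrite mulmx0.
  move: HEC; rewrite !mulmxA !SelC_assemble -scalemxAl scale0r !mul0mx.
  by rewrite mulmxDl -(mulmxA _ D0) D0H mulmx0 addr0 -mulmxA.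
have [->|kr] := eqVneq k rho; first by rewrite SelE -mulmxA PH mulmx0.
have [rk|] := ltnP rho k; last rewrite leq_eqVlt (negbTE kr) /= => kr'.
  elim: i ik => [|i IHi] ik; last first.
    by rewrite step //; [rewrite IHi ?mul0mx ?scaler0 // ltnW|exact: ltnW].
  have := congr1 (mulmx (Sel k 0)) D0H; rewrite mulmxA Sel_Dw //.
  have -> : wexp k 0 = 0%N by rewrite /wexp leqNgt rk /=; lia.
  by rewrite expr0 scale1r mulmx0.
have down j : (j <= k)%N -> Sel k (k - j) *m H = 0.
  elim: j => [|j IHj] jk; first by rewrite subn0 Sel_out ?mul0mx.
  have := step k (k - j.+1)%N km _ kr; rewrite subnSK // IHj; last exact: ltnW.
  rewrite [X in 0 ^+ X](_ : _ = 0%N); last by rewrite /wexp (ltnW kr'); lia.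
  rewrite expr0 scale1r => /(_ _)/esym E.
  by rewrite -[LHS](mulmxK Tu) E ?mul0mx //; lia.
by have := down (k - i)%N (leq_subr _ _); rewrite subKn // ltnW.
Qed.

(** In the rho-th group the B term carries a positive power of 0 except in the last row, where it
    becomes S_rho; the other rows are the shift. *)
Lemma limit_Theta (Z : 'M[K]_(n, \sum_(i < rho) s rho)) : P *m Z = 1%:M ->
  (forall k, (rho < k <= m)%N -> Sel k k.-1 *m B *m D0 *m Z = 0) ->
  V *m (D0 *m Z) = Erho m U rho *m IG0 m U Delta D rho /\
  P *m (A0 *m Z) = Theta rho S.
Proof.
move=> PZ last0.
have SZ i : Sel rho i *m Z = blk i by rewrite SelE -mulmxA PZ mulmx1.
have VD0 : V *m (D0 *m Z) =
    U rho 1 *m blk 0 + Emx U (from m rho.+1) *m (Gm *m blk 0).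
  rewrite basis_D0 SZ; congr (_ + _).
  rewrite -(SZ 0%N) -limit_first_rows //.
  by rewrite Emx_colstack.
split.
  by rewrite VD0 -Erho_IG IG0E.
apply: blksel_ext => i ik; rewrite mulmxA -SelE Sel_A0 // SZ blksel_Theta //.
rewrite /wexp leqnn subnn add0n; have [ei|ni] := eqVneq i.+1 rho.
  rewrite ei subnn expr0 scale1r blksel_out // add0r.
  have -> : i = rho.-1 by rewrite -ei.
  by rewrite Sel_last_B // Smx_mul -VD0 !mulmxA.
by rewrite expr0n subn_eq0 leqNgt ltn_neqAle ni ik /= scale0r addr0.
Qed.

(** The rho-th rows are replaced by the normalization P Z = 1. The resulting square system is
    injective, hence solvable, and the omitted rows hold afterwards by [limit_Theta]. *)
Lemma limit_solution :
  exists2 Z : 'M[K]_(n, \sum_(i < rho) s rho), P *m Z = 1%:M &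
  [/\ A0 *m Z = M0 *m Z *m Theta rho S,
      V *m (D0 *m Z) = Erho m U rho *m IG0 m U Delta D rho &
      P *m (A0 *m Z) = Theta rho S].
Proof.
have Tu : Theta rho S \in unitmx by apply/Theta_unit/Smx_unit.
pose A' : 'M[K]_n := assemble
  (fun k i => if k == rho then Sel k i else Sel k i *m A0) (SelC *m A0).
pose M' : 'M[K]_n := assemble
  (fun k i => if k == rho then 0 else Sel k i *m M0) (SelC *m M0).
have A'E k i b (H : 'M[K]_(n, b)) : (1 <= k <= m)%N -> (i < k)%N ->
    Sel k i *m (A' *m H) = if k == rho then Sel k i *m H else Sel k i *m (A0 *m H).
  by move=> km ik; rewrite mulmxA Sel_assemble //; case: eqP => // _; rewrite mulmxA.
have M'E k i b (H : 'M[K]_(n, b)) : (1 <= k <= m)%N -> (i < k)%N ->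
    Sel k i *m (M' *m H) = if k == rho then 0 else Sel k i *m (M0 *m H).
  move=> km ik; rewrite mulmxA Sel_assemble //.
  by case: eqP => // _; rewrite ?mul0mx ?mulmxA.
have inj (H : 'M[K]_(n, \sum_(i < rho) s rho)) :
    A' *m H = M' *m H *m Theta rho S -> H = 0.
  move=> E; apply: (limit_unique Tu).
  - apply: blksel_ext => i ik; rewrite mulmxA -SelE mulmx0.
    have := congr1 (mulmx (Sel rho i)) E.
    by rewrite -(mulmxA M') A'E // M'E // eqxx.
  - move=> k i km ik kr; have := congr1 (mulmx (Sel k i)) E.
    by rewrite -(mulmxA M') A'E // M'E // (negbTE kr) -(mulmxA M0).
  - by have := congr1 (mulmx SelC) E; rewrite !mulmxA !SelC_assemble.
have [L Lu LE] := sylvester_matrix inj.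
pose Z := vec_mx (mxvec P^T *m invmx L).
have ZE : A' *m Z - M' *m Z *m Theta rho S = P^T.
  by apply: (can_inj mxvecK); rewrite -LE vec_mxK mulmxKV.
have PZ : P *m Z = 1%:M.
  apply: blksel_ext => i ik; rewrite mulmxA -SelE mulmx1.
  have := congr1 (mulmx (Sel rho i)) ZE.
  by rewrite mulmxBr -(mulmxA M') A'E // M'E // eqxx subr0 Sel_topsel_tr.
have ZR k i : (1 <= k <= m)%N -> (i < k)%N -> k != rho ->
    Sel k i *m (A0 *m Z) = Sel k i *m (M0 *m Z *m Theta rho S).
  move=> km ik kr; have := congr1 (mulmx (Sel k i)) ZE.
  rewrite mulmxBr -(mulmxA M') A'E // M'E // (negbTE kr) Sel_topsel_tr0 //.
  by move/eqP; rewrite subr_eq0 -(mulmxA M0) => /eqP.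
have last0 k : (rho < k <= m)%N -> Sel k k.-1 *m B *m D0 *m Z = 0.
  move=> rk; rewrite -Sel_last_A0 // ZR; [|lia..].
  by rewrite -mulmxA Sel_last_M0.
have [VZ PAZ] := limit_Theta PZ last0.
exists Z => //; split=> //; apply: Sel_ext => [k i km ik|].
  have [->|kr] := eqVneq k rho; last exact: ZR.
  rewrite SelE -!(mulmxA (blk i)) PAZ -(mulmxA M0) (mulmxA P).
  by rewrite topsel_calM // (mulmxA P) PZ mul1mx.
have := congr1 (mulmx SelC) ZE.
rewrite mulmxBr !mulmxA !SelC_assemble SelC_topsel_tr => /eqP.
by rewrite subr_eq0 => /eqP.
Qed.

(* The linearization of Z |-> calA Z - calM Z P calA Z at the limit solution. *)
Lemma limit_linearization (Z : 'M[K]_(n, \sum_(i < rho) s rho)) :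
  P *m Z = 1%:M -> forall H : 'M[K]_(n, \sum_(i < rho) s rho),
  (A0 - M0 *m Z *m P *m A0) *m H = M0 *m H *m Theta rho S -> H = 0.
Proof.
move=> PZ H E; have Tu : Theta rho S \in unitmx by apply/Theta_unit/Smx_unit.
have PM0 : P *m M0 = P by apply: topsel_calM.
(* Since P M0 = P and P Z = 1, applying P annihilates the left side, and Theta is invertible. *)
have PH : P *m H = 0.
  have := congr1 (mulmx P) E.
  rewrite mulmxBl mulmxBr !mulmxA PM0 PZ mul1mx subrr.
  by move/(congr1 (mulmxr (invmx (Theta rho S)))); rewrite /= mul0mx mulmxK.
have E' : A0 *m H = M0 *m (Z *m (P *m (A0 *m H)) + H *m Theta rho S).
  by rewrite mulmxDr !mulmxA -E mulmxBl addrC subrK.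
have D0H : D0 *m H = 0.
  apply: limit_D0_eq0 => // k rk.
  by rewrite -Sel_last_A0 // E' Sel_last_M0.
have PA : P *m (A0 *m H) = 0.
  apply: blksel_ext => i ik; rewrite mulmx0 mulmxA -SelE Sel_A0 //.
  rewrite -!(mulmxA _ D0) D0H mulmx0 scaler0 addr0.
  by rewrite SelE -mulmxA PH mulmx0.
have E2 : A0 *m H = M0 *m H *m Theta rho S.
  by rewrite E' PA mulmx0 add0r mulmxA.
by apply: (limit_unique Tu PH) => [k i _ _ _|]; rewrite E2.
Qed.

End LimitProblem.

(** * Changes of basis in pencils and Gram matrices *)

Section MatrixIdentities.
Variable K : numClosedFieldType.

Lemma quadratic_shift a b (A M : 'M[K]_a) (P : 'M[K]_(b, a))
    (Z H : 'M[K]_(a, b)) :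
  (A - M *m Z *m P *m A) *m H + (A *m Z - M *m Z *m P *m A *m Z) =
    M *m H *m (P *m A *m Z + P *m A *m H) ->
  A *m (Z + H) = M *m (Z + H) *m (P *m A *m (Z + H)).
Proof.
move=> /eqP; rewrite -subr_eq0 => /eqP E; apply/eqP; rewrite -subr_eq0 -E.
by apply/eqP; mx_ring.
Qed.

Lemma pencil_change a b (A Dg : 'M[K]_a) e (Z : 'M[K]_(a, b))
    (Th T Ti : 'M[K]_b) :
  A *m (Dg *m Z) = e *: (Dg *m Z *m Th) -> T *m Ti = 1%:M ->
  A *m (Dg *m (Z *m T)) = e *: (Dg *m (Z *m T) *m (Ti *m Th *m T)).
Proof.
move=> AZ TTi; rewrite (mulmxA Dg) (mulmxA A) AZ -scalemxAl; congr (_ *: _).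
by rewrite -!mulmxA (mulmxA T) TTi mul1mx !mulmxA.
Qed.

Lemma pencil_transport a b (C D V A B : 'M[K]_a) (al x e : K)
    (Y : 'M[K]_(a, b)) (T : 'M[K]_b) :
  C *m V = V *m (al%:M + A) -> D *m V = V *m B ->
  (A + x *: B) *m Y = e *: (Y *m T) ->
  (C + x *: D) *m (V *m Y) = V *m Y *m (al%:M + e *: T).
Proof.
move=> CV DV AY; rewrite mulmxDl -scalemxAl !mulmxA CV DV.
rewrite -(mulmxA V B) scalemxAr -!(mulmxA V) -mulmxDr; congr (_ *m _).
rewrite mulmxDl -addrA [X in _ + X](_ : _ = (A + x *: B) *m Y); last first.
  by rewrite mulmxDl scalemxAl.
by rewrite AY mulmxDr scalar_mxC -scalemxAr.
Qed.

Lemma subspace_change a b c (A : 'M[K]_a) (Y : 'M[K]_(a, b)) (F : 'M[K]_(b, c))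
    (al e : K) (T : 'M[K]_b) (Om : 'M[K]_c) :
  A *m Y = Y *m (al%:M + e *: T) -> T *m F = F *m Om ->
  A *m (Y *m F) = Y *m F *m (al%:M + e *: Om).
Proof.
move=> AY TF; rewrite mulmxA AY -!mulmxA; congr (_ *m _).
by rewrite mulmxDl mulmxDr scalar_mxC -scalemxAl -scalemxAr TF.
Qed.

Lemma gram_change a b c (A : 'M[K]_a) (Y : 'M[K]_(a, b)) (F : 'M[K]_(b, c))
    (e : K) (G : 'M[K]_b) :
  Y^t* *m A *m Y = e *: G ->
  (Y *m F)^t* *m A *m (Y *m F) = e *: (F^t* *m G *m F).
Proof.
move=> YAY; rewrite adjM -!mulmxA (mulmxA _ A) (mulmxA (Y^t* *m A)) YAY.
by rewrite -scalemxAl -scalemxAr.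
Qed.

End MatrixIdentities.

(** * Block families and powers of t^(1/rho) *)

Section Families.
Variables (R : realType) (K : numClosedFieldType) (mod : modulus R K).
Local Notation bO := (bO mod).
Local Notation tends := (tends mod).

Lemma bO_col_mx a a' b d (A : R -> 'M[K]_(a, b)) (B : R -> 'M[K]_(a', b)) :
  bO d A -> bO d B -> bO d (fun t => col_mx (A t) (B t)).
Proof.
move=> AO BO.
have O1 := bO_add (bO_mull (col_mx 1%:M 0) AO) (bO_mull (col_mx 0 1%:M) BO).
apply: bO_ext O1 => t.
by rewrite !mul_col_mx !mul1mx !mul0mx add_col_mx addr0 add0r.
Qed.

Lemma bO_mxcol p (p_ : 'I_p -> nat) b d (Y : R -> forall i, 'M[K]_(p_ i, b)) :
  (forall i, bO d (fun t => Y t i)) -> bO d (fun t => \mxcol_i Y t i).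
Proof.
move=> YO; pose E := 1%:M : 'M[K]_(\sum_i p_ i).
have O1 := bO_sum (index_enum _) (fun i => bO_mull (submxrow E i) (YO i)).
apply: bO_ext O1 => t.
by rewrite -mul_mxrow_mxcol submxrowK mul1mx.
Qed.

Lemma tends_assemble m s q b d (f : R -> forall k i : nat, 'M[K]_(s k, b)) f0
    (g : R -> 'M[K]_(q, b)) g0 :
  (forall k i, tends d (fun t => f t k i) (f0 k i)) -> tends d g g0 ->
  tends d (fun t => assemble m (f t) (g t)) (assemble m f0 g0).
Proof.
move=> fO gO.
have O1 (j : 'I_m) : bO d (fun t => \mxcol_(i < j.+1) (f t j.+1 i - f0 j.+1 i)).
  by apply: bO_mxcol => i; apply: fO.
apply: bO_ext (bO_col_mx (bO_mxcol O1) gO) => t.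
rewrite opp_col_mx add_col_mx; congr col_mx.
rewrite -mxcolB; apply: eq_mxcol => j.
by rewrite -mxcolB.
Qed.

Variable rho : nat.
Hypothesis rho0 : (0 < rho)%N.
Local Notation d := (1 / rho%:R : R).
Definition root_t (t : R) : K := of_real mod (t `^ d).
Local Notation e := root_t.

Lemma d_gt0 : 0 < d.
Proof. by rewrite divr_gt0 // ltr0n. Qed.

Lemma root_tX t k : e t ^+ k = of_real mod (t `^ (k%:R / rho%:R)).
Proof.
rewrite -rmorphXn /=; congr (of_real mod _).
by rewrite -powR_mulrn ?powR_ge0 // -powRrM mulrC mulrA mulr1.
Qed.

Lemma root_t_rho t : 0 < t -> e t ^+ rho = of_real mod t.
Proof.
move=> t0; rewrite root_tX divff ?pnatr_eq0 -?lt0n // powRr1 //.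
exact: ltW.
Qed.

Lemma root_t_pred t : e t ^+ rho.-1 = of_real mod (t `^ (1 - 1 / rho%:R)).
Proof.
rewrite root_tX; congr (of_real mod (_ `^ _)).
have -> : rho.-1%:R = rho%:R - 1 :> R.
  by rewrite -[in RHS](prednK rho0) -natr1 addrK.
by rewrite mulrBl divff // pnatr_eq0 -lt0n.
Qed.

Lemma root_t_neq0 t : 0 < t -> e t != 0.
Proof. by move=> t0; rewrite fmorph_eq0 gt_eqF // powR_gt0. Qed.

Lemma root_t_conj t : Num.conj (e t) = e t.
Proof. exact: conj_of_real. Qed.

Lemma bO_root_t a b k d' (A : R -> 'M[K]_(a, b)) : bO d' A ->
  bO (k%:R / rho%:R + d') (fun t => e t ^+ k *: A t).
Proof. by move=> AO; apply: bO_ext (bO_powR _ AO) => t; rewrite root_tX. Qed.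

(** As 0 ^+ 0 = 1, one formula covers both cases: exponent 0 keeps the limit, a positive one kills a
    bounded family at rate at least 1/rho. *)
Lemma tends_root_t a b k (A : R -> 'M[K]_(a, b)) A0 : tends d A A0 ->
  tends d (fun t => e t ^+ k *: A t) (0 ^+ k *: A0).
Proof.
case: k => [|k] AO.
  rewrite [in X in tends _ _ X]expr0 scale1r.
  by apply: tends_ext AO => t; rewrite expr0 scale1r.
have := bO_root_t k.+1 (tends_bO (ltW d_gt0) AO); rewrite addr0 => O1.
rewrite expr0n scale0r.
apply: bO_ext (bO_le _ O1) => [t|]; first by rewrite subr0.
by rewrite ler_pM2r ?invr_gt0 ?ltr0n // ler1n.
Qed.

End Families.

(** * Perturbed structured bases *)

Section StructuredBasis.
Variables (R : realType) (K : numClosedFieldType) (mod : modulus R K).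
Local Notation bO := (bO mod).
Local Notation tends := (tends mod).
Variables (m : nat) (s tau : nat -> nat) (q rho : nat).
Hypothesis rho_m : (1 <= rho <= m)%N.
Local Notation n := (total_size m s + q)%N.
Local Notation Sel := (Sel K m s q).
Local Notation SelC := (SelC K m s q).
Local Notation P := (topsel K m s q rho).
Local Notation blk := (blksel K rho (s rho)).
Local Notation wexp := (wexp rho).
Local Notation e := (root_t mod rho).
Local Notation d := (1 / rho%:R : R).
Local Notation Dwt t := (Dw m s q rho (e t)).
Local Notation D0 := (Dw m s q rho (0 : K)).

Let rho0 : (0 < rho)%N. Proof. by case/andP: rho_m. Qed.

Lemma tends_Dw : tends d (fun t => Dwt t) D0.
Proof.
apply: tends_assemble => [k i|]; apply: tends_root_t => //; exact: tends_const.
Qed.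

Lemma tends_calA (B : 'M[K]_n) (X : 'M[K]_q) :
  tends d (fun t => calA rho B X (e t)) (calA rho B X 0).
Proof.
have d0 := ltW (d_gt0 R rho0).
have BO (M : 'M[K]_n) b (Q : 'M[K]_(b, n)) :
    tends d (fun t => Q *m M *m Dwt t) (Q *m M *m D0).
  exact: tends_mul d0 (tends_const _ _ _) tends_Dw.
apply: tends_assemble => [k i|]; apply: tends_add (tends_const _ _ _) _.
  exact (tends_root_t rho0 (rho - wexp k i.+1) (BO B _ (Sel k i))).
exact (BO B _ SelC).
Qed.

Lemma tends_calM :
  tends d (fun t => calM m s q rho (e t)) (calM m s q rho (0 : K)).
Proof.
apply: tends_assemble => [k i|].
  by apply: tends_root_t => //; apply: tends_const.
exact: (tends_root_t rho0 1 (tends_const _ _ _)).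
Qed.

Lemma tends_Gram (DeltaC : 'M[K]_q) :
  tends d (fun t => Gram m s tau rho DeltaC (e t)) (Gram m s tau rho DeltaC 0).
Proof.
by apply: tends_assemble => [k i|]; apply: tends_root_t => //; apply: tends_const.
Qed.

Section RowEstimates.
Variables (c : nat) (Z : 'M[K]_(n, c)) (Y : R -> 'M[K]_(n, c)).
Hypothesis YZ : tends d Y Z.
Local Notation err t := (Dwt t *m Y t - D0 *m Z).

Lemma err_tail : bO 1 (fun t => SelC *m err t).
Proof.
have O0 := bO_mull SelC (tends_bO (ltW (d_gt0 R rho0)) YZ).
have := bO_root_t rho rho O0; rewrite addr0 divff ?pnatr_eq0 -?lt0n //.
apply: bO_ext => t; rewrite mulmxBr !mulmxA !SelC_Dw -!scalemxAl expr0n.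
by rewrite gtn_eqF // scale0r subr0.
Qed.

(** A row of weight 0 has the error of Y itself; for positive weight the limit row is 0 and the row
    is a power of e times a bounded one. *)
Lemma err_row k i : (1 <= k <= m)%N ->
  bO (if wexp k i == 0%N then d else (wexp k i)%:R / rho%:R)
     (fun t => Sel k i *m err t).
Proof.
move=> km; case: eqP => [w0|/eqP w0].
  apply: bO_ext (bO_mull (Sel k i) YZ) => t.
  by rewrite mulmxBr !mulmxA !Sel_Dw // w0 !expr0 !scale1r -mulmxBr.
have O0 := bO_mull (Sel k i) (tends_bO (ltW (d_gt0 R rho0)) YZ).
have := bO_root_t rho (wexp k i) O0; rewrite addr0; apply: bO_ext => t.
rewrite mulmxBr !mulmxA !Sel_Dw // -!scalemxAl expr0n (negbTE w0) scale0r.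
by rewrite subr0.
Qed.

Lemma err_rows_neq k : (1 <= k <= m)%N -> k != rho ->
  forall i : 'I_k, bO (delta_exp R rho i)
    (fun t => submxcol (topsel K m s q k *m err t) i).
Proof.
move=> km kr i.
have : bO (delta_exp R rho i) (fun t => Sel k i *m err t); last first.
  by apply: bO_ext => t; rewrite submxcol_blksel SelE -mulmxA.
have := err_row i km; congr (bO _ _); have ik := ltn_ord i.
rewrite /delta_exp /wexp; have [kr'|kr'|] := ltngtP k rho; last by move/eqP: kr.
  rewrite ifF; last by apply/negbTE; lia.
  rewrite -(subKn (_ : k - i <= rho)%N) //; last by lia.
  rewrite (_ : rho - k + i = rho - (k - i))%N; last by lia.
  rewrite subKn; last by lia.
  by rewrite natrB ?mulrBl ?divff // ?pnatr_eq0 -?lt0n //; lia.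
have [->|i0] := eqVneq (i : nat) 0%N; first by rewrite min0n eqxx.
by rewrite ifF //; apply/negbTE; lia.
Qed.

(** After subtraction of [Lead], row i is e^i times the error of Y, which gains one power of e. *)
Lemma err_rows_rho (Lead : R -> 'M[K]_(\sum_(i < rho) s rho, c)) :
  (forall t i, (i < rho)%N -> blk i *m Lead t =
     if i == 0%N then 0 else e t ^+ i *: (blk i *m (P *m Z))) ->
  forall i : 'I_rho, bO (delta_exp R rho i)
    (fun t => submxcol (P *m err t - Lead t) i).
Proof.
move=> LeadE i; have ir := ltn_ord i.
have O1 := bO_root_t rho i (bO_mull (Sel rho i) YZ).
have -> : delta_exp R rho i = i%:R / rho%:R + d.
  by rewrite /delta_exp ltnn eqxx -mulrDl natr1.
apply: bO_ext O1 => t; rewrite submxcol_blksel mulmxBr LeadE //.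
rewrite !(mulmxA (blk i)) -!SelE !mulmxBr !(mulmxA (Sel rho i) (Dw _ _ _ _ _)).
rewrite !Sel_Dw // /wexp leqnn subnn add0n -!scalemxAl scalerBr expr0n.
by case: eqP => [->|_]; rewrite ?expr0 ?scale1r ?scale0r subr0.
Qed.

End RowEstimates.

Variables (U : forall k i : nat, 'M[K]_(n, s k)) (UC : 'M[K]_(n, q)).
Local Notation V := (row_mx (UT m U) UC).
Variables (Delta D : 'M[K]_n) (DeltaC X : 'M[K]_q).
Hypothesis Delta_adj : Delta^t* = Delta.
Hypothesis V_unit : V \in unitmx.
Hypothesis Gram_V : V^t* *m Delta *m V = block_mx (DeltaT K m s tau) 0 0 DeltaC.
Hypothesis X_unit : X \in unitmx.
Hypothesis W_unit : forall k : nat, (1 <= k <= m)%N ->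
  Wmx tau U Delta D (from m k) \in unitmx.
Local Notation B := (invmx V *m D *m V).
Local Notation A := (block_mx (Nmx K m s) 0 0 X).
Local Notation S := (Smx m tau U Delta D rho).

Lemma scaled_basis : exists Z Y Tt, [/\ P *m Z = 1%:M,
    V *m (D0 *m Z) = Erho m U rho *m IG0 m U Delta D rho,
    tends d Y Z, tends d Tt (Theta rho S) &
    \forall t \near 0^'+,
      (A + e t ^+ rho *: B) *m (Dwt t *m Y t) =
        e t *: (Dwt t *m Y t *m Tt t) /\
      (V *m (Dwt t *m Y t))^t* *m Delta *m (V *m (Dwt t *m Y t)) =
        e t ^+ rho.-1 *: Gammamx K s tau rho].
Proof.
have d0 := d_gt0 R rho0.
have [Z PZ [AZ VZ PAZ]] := limit_solution rho_m V_unit Gram_V X_unit W_unit.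
have lin := limit_linearization rho_m V_unit Gram_V X_unit W_unit PZ.
pose At t := calA rho B X (e t); pose Mt t := calM m s q rho (e t).
have AO : tends d At (calA rho B X 0) := tends_calA B X.
have MO : tends d Mt (calM m s q rho 0) := tends_calM.
have cst a b (Q : 'M[K]_(a, b)) : tends d (fun=> Q) Q := tends_const mod d Q.
have PO := tends_mul (ltW d0) (cst _ _ P) AO.
have TO := tends_mul (ltW d0) PO (cst _ _ Z).
have MZO := tends_mul (ltW d0) MO (cst _ _ Z).
have MZPA := tends_mul (ltW d0) (tends_mul (ltW d0) MZO (cst _ _ P)) AO.
have LO := tends_sub AO MZPA.
(* The constant term vanishes at e = 0 because Z solves the limit equation. *)
have cO : bO d (fun t => At t *m Z - Mt t *m Z *m P *m At t *m Z).
  have := tends_sub (tends_mul (ltW d0) AO (cst _ _ Z))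
    (tends_mul (ltW d0) MZPA (cst _ _ Z)).
  have E0 : calA rho B X 0 *m Z
      - calM m s q rho 0 *m Z *m P *m calA rho B X 0 *m Z = 0.
    by rewrite -!(mulmxA _ _ Z) -(mulmxA _ P) PAZ AZ -mulmxA subrr.
  by apply: bO_ext => t; rewrite E0 subr0.
rewrite -(mulmxA P) PAZ in TO.
have [[H HO Heq] _] := quadratic_perturbation d0 LO MO TO PO cO lin.
pose Zt t := Z + H t.
have ZO : tends d Zt Z by apply: bO_ext HO => t; rewrite /Zt addrAC subrr add0r.
pose Tht t := P *m At t *m Zt t.
have ThO : tends d Tht (Theta rho S).
  by rewrite -PAZ mulmxA; apply: tends_mul (ltW d0) PO ZO.
have Zeq : \forall t \near 0^'+, At t *m Zt t = Mt t *m Zt t *m Tht t.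
  by apply: filterS Heq => t; apply: quadratic_shift.
pose G t := (Zt t)^t* *m Gram m s tau rho DeltaC (e t) *m Zt t.
have GO : tends d G (Gammamx K s tau rho).
  have PT : P^t* = P^T by rewrite -map_trmx conj_topsel.
  have <- : Z^t* *m Gram m s tau rho DeltaC 0 *m Z = Gammamx K s tau rho.
    by rewrite Gram0 // -PT !mulmxA -adjM PZ adj1 mul1mx -mulmxA PZ mulmx1.
  exact: tends_mul (ltW d0)
    (tends_mul (ltW d0) (tends_adj ZO) (tends_Gram DeltaC)) ZO.
have GE t : (V *m (Dwt t *m Zt t))^t* *m Delta *m (V *m (Dwt t *m Zt t)) =
    e t ^+ rho.-1 *: G t.
  rewrite !adjM Dw_adj ?root_t_conj // -!mulmxA.
  rewrite (mulmxA Delta) (mulmxA (V^t*)) (mulmxA (V^t*) Delta) Gram_V.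
  rewrite (mulmxA (block_mx _ _ _ _)) (mulmxA (Dwt t)) (mulmxA (Dwt t)).
  by rewrite Gram_scaled // -scalemxAl -scalemxAr mulmxA.
(* Symmetry is inherited from Delta, after cancelling the nonzero real factor e^(rho-1). *)
have G_adj : \forall t \near 0^'+, (G t)^t* = G t.
  apply: filterS (@near_pos R) => t t0.
  have e0 : e t ^+ rho.-1 != 0 by rewrite expf_neq0 // root_t_neq0.
  have M_adj p (M : 'M[K]_(n, p)) : (M^t* *m Delta *m M)^t* = M^t* *m Delta *m M.
    by rewrite !adjM trmxCK Delta_adj mulmxA.
  have := M_adj _ (V *m (Dwt t *m Zt t)); rewrite GE linearZ map_mxZ rmorphXn /=.
  by rewrite root_t_conj => /(scalerI e0).
have [T [Ti [TO1 TiO Teq]]] :=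
  perturbed_normalization d0 (Gammamx_unit K s tau rho)
    (Gammamx_adj K s tau rho) GO G_adj.
exists Z, (fun t => Zt t *m T t), (fun t => Ti t *m Tht t *m T t); split => //.
- by rewrite -[X in tends d _ X]mulmx1; apply: tends_mul (ltW d0) ZO TO1.
- rewrite -[X in tends d _ X]mulmx1 -[X in tends d _ (X *m _)]mul1mx.
  by apply: tends_mul (ltW d0) (tends_mul (ltW d0) TiO ThO) TO1.
apply: filterS2 Zeq Teq => t Zt_eq [TGT TTi _]; split.
  by apply: pencil_change TTi; apply: pencil_scaled.
have -> : V *m (Dwt t *m (Zt t *m T t)) = V *m (Dwt t *m Zt t) *m T t.
  by rewrite !mulmxA.
by rewrite (gram_change _ (GE t)) TGT.
Qed.

(* W = E0 + sum_k U_k L_k + O(t) with coefficients L_k of the orders delta_k;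
   Lead runs over the possible ways to write diag(0, eps I, ..., eps^(rho-1) I) Q. *)
Definition basis_expansion c (E0 : 'M[K]_(n, c))
    (Q : 'M[K]_(\sum_(i < rho) s rho, c)) (W : R -> 'M[K]_(n, c))
    (L : forall k : nat, R -> 'M[K]_(\sum_(i < k) s k, c)) :=
  [/\ bO 1 (fun t => W t - (E0 + \sum_(1 <= k < m.+1) Ublock U k *m L k t)),
      forall k : nat, (1 <= k <= m)%N -> k != rho -> forall i : 'I_k,
        bO (delta_exp R rho i) (fun t => submxcol (L k t) i)
    & forall Lead : R -> 'M[K]_(\sum_(i < rho) s rho, c),
        (forall t i, (i < rho)%N -> blk i *m Lead t =
           if i == 0%N then 0 else e t ^+ i *: (blk i *m Q)) ->
        forall i : 'I_rho, bO (delta_exp R rho i)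
          (fun t => submxcol (L rho t - Lead t) i)].

Lemma basis_expansionP c (Z : 'M[K]_(n, c)) (Y : R -> 'M[K]_(n, c)) :
  tends d Y Z ->
  basis_expansion (V *m (D0 *m Z)) (P *m Z) (fun t => V *m (Dwt t *m Y t))
    (fun k t => topsel K m s q k *m (Dwt t *m Y t - D0 *m Z)).
Proof.
move=> YZ; split.
- apply: bO_ext (bO_mull UC (err_tail YZ)) => t.
  have := basis_mul U UC (Dwt t *m Y t - D0 *m Z).
  rewrite mulmxBr => /eqP; rewrite subr_eq => /eqP ->.
  by rewrite addrAC -addrA [X in _ + X]addrC -[X in _ = X]addr0; mx_abel.
- exact: err_rows_neq.
- exact: err_rows_rho.
Qed.

(** The second expansion is not obtained by multiplying the first: the scaled coordinates Y Ft
    converge to Z F, so [basis_expansionP] applies to them directly, with P Z F = F. *)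
Lemma perturbed_bases (C : 'M[K]_n) (al : K) l
    (F : 'M[K]_(\sum_(i < rho) s rho, l)) (Om L : 'M[K]_l) :
  C *m V = V *m (al%:M + A) -> \rank F = l ->
  Theta rho S *m F = F *m Om ->
  F^t* *m Gammamx K s tau rho *m F = L -> L \in unitmx -> L^t* = L ->
  (spectrum Om `&` (spectrum (Theta rho S) `\` spectrum Om) = mset0)%mset ->
  exists Ut Tt Ft Ot X Lt,
    [/\ [/\ tends d Tt (Theta rho S), tends d Ft F & tends d Ot Om],
        basis_expansion (Erho m U rho *m IG0 m U Delta D rho) 1%:M Ut X,
        basis_expansion (Erho m U rho *m IG0 m U Delta D rho *m F) F
          (fun t => Ut t *m Ft t) Lt
      & \forall t \near 0^'+,
        [/\ (C + of_real mod t *: D) *m Ut t = Ut t *m (al%:M + e t *: Tt t),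
            (Ut t)^t* *m Delta *m Ut t =
              of_real mod (t `^ (1 - 1 / rho%:R)) *: Gammamx K s tau rho,
            Tt t *m Ft t = Ft t *m Ot t
          & (Ft t)^t* *m Gammamx K s tau rho *m Ft t = L]].
Proof.
move=> CV rF TF FGF Lu Lh disj; have d0 := d_gt0 R rho0.
have [Z [Y [Tt [PZ VZ YO TtO near_eqs]]]] := scaled_basis.
have [Fh [Oh [FhO OhO near_inv]]] :=
  invariant_subspace_perturbation d0 rF TF disj TtO.
pose G t := (Fh t)^t* *m Gammamx K s tau rho *m Fh t.
have GO : tends d G L.
  rewrite -FGF; apply: (tends_mul (ltW d0) _ FhO).
  exact: (tends_mul (ltW d0) (tends_adj FhO) (tends_const _ _ _)).
have G_adj : \forall t \near 0^'+, (G t)^t* = G t.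
  by near=> t; rewrite !adjM trmxCK Gammamx_adj mulmxA.
have [T [Ti [TO TiO near_T]]] := perturbed_normalization d0 Lu Lh GO G_adj.
have FtO : tends d (fun t => Fh t *m T t) F.
  by rewrite -[X in tends d _ X]mulmx1; apply: (tends_mul (ltW d0) FhO TO).
exists (fun t => V *m (Dwt t *m Y t)), Tt, (fun t => Fh t *m T t),
  (fun t => Ti t *m Oh t *m T t).
exists (fun k t => topsel K m s q k *m (Dwt t *m Y t - D0 *m Z)),
  (fun k t => topsel K m s q k *m
     (Dwt t *m (Y t *m (Fh t *m T t)) - D0 *m (Z *m F))).
split.
- split=> //; rewrite -[X in tends d _ X]mulmx1 -[X in tends d _ (X *m _)]mul1mx.
  by apply: tends_mul (ltW d0) (tends_mul (ltW d0) TiO OhO) TO.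
- by rewrite -VZ -PZ; apply: basis_expansionP.
- have := basis_expansionP (tends_mul (ltW d0) YO FtO).
  rewrite (mulmxA P) PZ mul1mx (mulmxA D0) (mulmxA V) VZ.
  suff -> : (fun t => V *m (Dwt t *m Y t) *m (Fh t *m T t)) =
    (fun t => V *m (Dwt t *m (Y t *m (Fh t *m T t)))) by [].
  by apply/funext => t; rewrite !mulmxA.
near=> t; have t0 : 0 < t by near: t; apply: near_pos.
have [AY YGY] : (A + e t ^+ rho *: B) *m (Dwt t *m Y t) =
      e t *: (Dwt t *m Y t *m Tt t) /\
    (V *m (Dwt t *m Y t))^t* *m Delta *m (V *m (Dwt t *m Y t)) =
      e t ^+ rho.-1 *: Gammamx K s tau rho by near: t.
have [TGT TTi _] : [/\ (T t)^t* *m G t *m T t = L, T t *m Ti t = 1%:M &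
    Ti t *m T t = 1%:M] by near: t.
have TtFh : Tt t *m Fh t = Fh t *m Oh t by near: t.
split.
- rewrite -(root_t_rho mod rho0 t0); apply: pencil_transport CV _ AY.
  by rewrite -!mulmxA mulKVmx.
- by rewrite YGY root_t_pred.
- by rewrite mulmxA TtFh -!mulmxA (mulmxA (T t)) TTi mul1mx.
- by rewrite adjM -TGT /G !mulmxA.
Unshelve. all: by end_near. Qed.

End StructuredBasis.

Theorem theorem9 (R : realType)
  (m : nat) (s tau : nat -> nat) (q : nat)
  (hm : (1 <= m)%N) (hsm : (0 < s m)%N)
  (htau : forall k : nat, (1 <= k <= m)%N -> (tau k <= s k)%N)
  (Delta C D : 'M[R[i]]_(total_size m s + q))
  (hDelta : Delta \is hermsymmx) (hDelta_unit : Delta \in unitmx)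
  (hC : Delta *m C \is hermsymmx) (hD : Delta *m D \is hermsymmx)
  (alpha : R)
  (U : forall k i : nat, 'M[R[i]]_(total_size m s + q, s k))
  (UC : 'M[R[i]]_(total_size m s + q, q))
  (CC DeltaC : 'M[R[i]]_q)
  (hU_unit : row_mx (UT m U) UC \in unitmx)
  (hCU : C *m row_mx (UT m U) UC =
    row_mx (UT m U) UC *m block_mx ((alpha%:C)%:M + Nmx _ m s) 0 0 CC)
  (hDeltaU : (row_mx (UT m U) UC)^t* *m Delta *m row_mx (UT m U) UC =
    block_mx (DeltaT _ m s tau) 0 0 DeltaC)
  (halpha : alpha%:C \notin spectrum CC)
  (hW : forall k : nat, (1 <= k <= m)%N ->
    Wmx tau U Delta D (from m k) \in unitmx)
  (rho : nat) (hrho : (1 <= rho <= m)%N)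
  (l : nat) (F : 'M[R[i]]_(\sum_(i < rho) s rho, l))
  (Omega DeltaOmega : 'M[R[i]]_l) (Q : 'M[R[i]]_(s rho, l))
  (hF_rank : \rank F = l)
  (hThetaF : Theta rho (Smx m tau U Delta D rho) *m F = F *m Omega)
  (hFGammaF : F^t* *m Gammamx _ s tau rho *m F = DeltaOmega)
  (hF : F = \mxcol_(i < rho) (Q *m Omega ^+ i))
  (hSQ : Smx m tau U Delta D rho *m Q = Q *m Omega ^+ rho)
  (hDO : DeltaOmega \is hermsymmx) (hDO_can : canonical_form DeltaOmega)
  (hsub : (spectrum Omega
    `<=` spectrum (Theta rho (Smx m tau U Delta D rho)))%mset)
  (hconj : forall z : R[i], spectrum Omega (z^*)%R = spectrum Omega z)
  (hdisj : (spectrum Omega `&`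
    (spectrum (Theta rho (Smx m tau U Delta D rho)) `\` spectrum Omega)
      = mset0)%mset) :
  exists (Ut : R -> 'M[R[i]]_(total_size m s + q, \sum_(i < rho) s rho))
         (Tt : R -> 'M[R[i]]_(\sum_(i < rho) s rho))
         (Ft : R -> 'M[R[i]]_(\sum_(i < rho) s rho, l))
         (Ot : R -> 'M[R[i]]_l)
         (L : forall k : nat, R -> 'M[R[i]]_(\sum_(i < k) s k, l)),
    [/\ perturbed_structured_basis m tau U Delta C D alpha Ut Tt,
        [/\ bigO_t (1 / rho%:R) (fun t => Ft t - F),
            bigO_t (1 / rho%:R) (fun t => Ot t - Omega)
          & \forall t \near 0^'+,
              Tt t *m Ft t = Ft t *m Ot t
              /\ (Ft t)^t* *m Gammamx _ s tau rho *m Ft t = DeltaOmega],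
        [/\ bigO_t 1 (fun t => Ut t *m Ft t -
              (Erho m U rho *m IG m U Delta D rho *m Q +
               \sum_(1 <= k < m.+1) Ublock U k *m L k t)),
            forall k : nat, (1 <= k <= m)%N -> k != rho ->
              bigO_rows (@delta_exp R rho k) (L k)
          & bigO_rows (@delta_exp R rho rho) (fun t => L rho t -
              \mxcol_(i < rho)
                (if i == 0%N :> nat then 0
                 else Q *m (tpow t (1 / rho%:R) *: Omega) ^+ i))]
      & \forall t \near 0^'+,
          (C + t%:C *: D) *m (Ut t *m Ft t) =
            (Ut t *m Ft t) *m ((alpha%:C)%:M + tpow t (1 / rho%:R) *: Ot t)
          /\ (Ut t *m Ft t)^t* *m Delta *m (Ut t *m Ft t) =
            tpow t (1 - 1 / rho%:R) *: DeltaOmega].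
Proof.
have /andP[rho1 rhom] := hrho.
have Delta_adj := hermsymmx_adj hDelta.
(* Subtracting alpha in the U_C block too makes alpha a global shift and leaves an invertible
   block. *)
have X_unit : CC - (alpha%:C)%:M \in unitmx := notin_spectrum_unit halpha.
have CV : C *m row_mx (UT m U) UC = row_mx (UT m U) UC *m
    ((alpha%:C)%:M + block_mx (Nmx _ m s) 0 0 (CC - (alpha%:C)%:M)).
  exact: etrans hCU (congr1 (mulmx _) (esym (scalar_add_block _ _ _))).
have blkF i : (i < rho)%N -> blksel _ rho (s rho) i *m F = Q *m Omega ^+ i.
  by move=> ir; rewrite hF (blksel_mxcol _ ir).
have IGQ : IG0 m U Delta D rho *m F = IG m U Delta D rho *m Q.
  by rewrite IG0E -mulmxA (blkF 0%N rho1) expr0 mulmx1.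
have [Ut [Tt [Ft [Ot [X [L [[TtO FtO OtO] XP LP near_eqs]]]]]]] :=
  perturbed_bases (complex_modulus R) hrho Delta_adj hU_unit hDeltaU X_unit hW
    CV hF_rank hThetaF hFGammaF (canonical_form_unit hDO_can)
    (hermsymmx_adj hDO) hdisj.
have [X1 X2 X3] := XP; have [L1 L2 L3] := LP.
exists Ut, Tt, Ft, Ot, L; split.
- split; first exact: bO_bigO TtO.
    exists X; split; first exact: bO_bigO X1.
      by move=> k km kr i; apply: bO_bigO (X2 k km kr i).
    move=> i; apply: bO_bigO; apply: (X3 (Xlead rho (s rho))) => t j jr.
    rewrite (blksel_mxdiag _ jr) /= mulmx1 root_tX.
    by case: eqP => _; rewrite ?mul0mx // mul_scalar_mx.
  by apply: filterS near_eqs => t [E1 E2 _ _]; split.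
- split; [exact: bO_bigO FtO|exact: bO_bigO OtO|].
  by apply: filterS near_eqs => t [_ _ E3 E4]; split.
- split.
  + by rewrite -mulmxA -IGQ mulmxA; apply: bO_bigO L1.
  + by move=> k km kr i; apply: bO_bigO (L2 k km kr i).
  + move=> i; apply: bO_bigO; apply: L3 => t j jr.
    rewrite (blksel_mxcol _ jr) /= blkF //; case: eqP => // _.
    by rewrite scale_expmx -scalemxAr.
- apply: filterS near_eqs => t [E1 E2 E3 E4]; split.
    exact: subspace_change E1 E3.
  by rewrite (gram_change _ E2) E4.
Qed.
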